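(* Let $H$ be a Hopf algebra and let $B=P^{co H}\subseteq P$ be a faithfully flat Hopf–Galois extension, with Ehresmann–Schauenburg Hopf algebroid $\mathcal L(P,H)$. Then there is a group isomorphism $\mathcal B(\mathcal L(P,H))\simeq\mathrm{Aut}_H(P)$. If moreover $H$ has invertible antipode, then there is also a group isomorphism $\mathrm{Aut}_H(P)\simeq\mathcal B^R(\mathcal L(P,H))$.
   Context: All algebras are unital associative over a field $k$ and algebra maps are unital. Let $P$ be a right $H$-comodule algebra with coaction $\Delta_R(p)=p_{(0)}\otimes p_{(1)}$ and $B=P^{co H}=\{b\in P:\Delta_R(b)=b\otimes 1\}$. The extension $B\subseteq P$ is Hopf–Galois if $\chi:P\otimes_BP\to P\otimes H$, $q\otimes_Bp\mapsto qp_{(0)}\otimes p_{(1)}$ is bijective; the translation map is $\tau(h)=\chi^{-1}(1\otimes h)=h^{<1>}\otimes_Bh^{<2>}$. The extension is faithfully flat if $P$ is a faithfully flat left $B$-module. $\mathrm{Aut}_H(P)$ is the group, under composition, of invertible right $H$-comodule unital algebra maps $P\to P$. The Ehresmann–Schauenburg Hopf algebroid is $\mathcal L(P,H)=(P\otimes P)^{co H}=\{p\otimes q\in P\otimes P:\ p_{(0)}\otimes q_{(0)}\otimes p_{(1)}q_{(1)}=p\otimes q\otimes 1\}$ (sums understood), with product $(p\otimes q)(r\otimes u)=pr\otimes uq$, source $s(b)=b\otimes1$, target $t(b)=1\otimes b$, $B$-bimodule structure $b.X.c=s(b)t(c)X$ (i.e. $b.(p\otimes q).c=bp\otimes qc$),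 coproduct $\Delta(p\otimes q)=(p_{(0)}\otimes p_{(1)}{}^{<1>})\otimes_B(p_{(1)}{}^{<2>}\otimes q)$ and counit $\varepsilon(p\otimes q)=pq$. It is a left bialgebroid over $B$; write $\Delta(X)=X_{(1)}\otimes_BX_{(2)}$. A left bisection on a left bialgebroid $\mathcal L$ over $B$ is a unital linear map $\sigma:\mathcal L\to B$ such that (1) $\sigma(t(b)X)=\sigma(X)b$; (2) $\phi:=\sigma\circ s\in\mathrm{Aut}(B)$ (algebra automorphisms); (3) $\sigma(XY)=\sigma(Xt(\sigma(Y)))=\sigma(Xs(\phi^{-1}(\sigma(Y))))$ for all $b\in B$, $X,Y\in\mathcal L$. The set $\mathcal B(\mathcal L)$ has product $(\sigma\ast\eta)(X)=\sigma(s(\eta(X_{(1)}))X_{(2)})$ and identity $\varepsilon$. A right bisection is a unital linear map $\sigma:\mathcal L\to B$ such that (1) $\sigma(s(b)X)=b\sigma(X)$; (2) $\psi:=\sigma\circ t\in\mathrm{Aut}(B)$; (3) $\sigma(XY)=\sigma(Xs(\sigma(Y)))=\sigma(Xt(\psi^{-1}(\sigma(Y))))$ for all $b,X,Y$. The set $\mathcal B^R(\mathcal L)$ has product $(\sigma\bullet\eta)(X)=\sigma(t(\eta(X_{(2)}))X_{(1)})$ and identity $\varepsilon$. *)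

(* Defs.v *)
From HB Require Import structures.
From mathcomp Require Import all_boot all_algebra.
From mathcomp Require Import boolp classical_sets functions.

Set Implicit Arguments.
Unset Strict Implicit.
Unset Printing Implicit Defensive.

Import GRing.Theory.
Local Open Scope classical_set_scope.
Local Open Scope ring_scope.
Local Open Scope quotient_scope.


(* Tensor products. [r : M -> A -> M] and [l : A -> N -> N] are the right and
   left actions of the scalars; [tens r l] is the quotient of the free
   commutative monoid on [M * N] (finite formal sums) by the congruence
   generated by biadditivity and balancing. *)
Section Tensor.
Variables (A : Type) (M N : zmodType) (r : M -> A -> M) (l : A -> N -> N).

Inductive tens_eqv : seq (M * N) -> seq (M * N) -> Prop :=
| TRefl s : tens_eqv s s
| TSym s t : tens_eqv s t -> tens_eqv t s
| TTrans t s u : tens_eqv s t -> tens_eqv t u -> tens_eqv s u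
| TCat s s' t t' : tens_eqv s s' -> tens_eqv t t' -> tens_eqv (s ++ t) (s' ++ t')
| TComm s t : tens_eqv (s ++ t) (t ++ s)
| TZero n : tens_eqv [:: (0, n)] [::]
| TAddl m m' n : tens_eqv [:: (m + m', n)] [:: (m, n); (m', n)]
| TAddr m n n' : tens_eqv [:: (m, n + n')] [:: (m, n); (m, n')]
| TBal m a n : tens_eqv [:: (r m a, n)] [:: (m, l a n)].

Definition tens_rel : rel (seq (M * N)) := fun s t => `[< tens_eqv s t >].

Lemma tens_rel_equiv : equiv_class_of tens_rel.
Proof.
split=> [s|s t|t s u].
- exact/asboolP/TRefl.
- by apply/asboolP/asboolP; apply: TSym.
- by move=> /asboolP st /asboolP tu; apply/asboolP/(TTrans st tu).
Qed.

Canonical tens_equiv := EquivRelPack tens_rel_equiv.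

Definition tens := {eq_quot tens_equiv}.
HB.instance Definition _ := Choice.on tens.

Definition tpi (s : seq (M * N)) : tens := \pi_({eq_quot tens_equiv}) s.
Definition trepr (x : tens) : seq (M * N) := repr (x : {eq_quot tens_equiv}).

Lemma treprK x : tpi (trepr x) = x.
Proof. exact: reprK. Qed.

Lemma tens_eqP s t : tens_eqv s t <-> tpi s = tpi t.
Proof. by split=> [/asboolP st|/eqmodP /asboolP //]; apply/eqmodP. Qed.

Lemma tens_reprP s : tens_eqv (trepr (tpi s)) s.
Proof. by apply/tens_eqP; rewrite treprK. Qed.

Definition tens_zero : tens := tpi [::].
Definition tens_add (x y : tens) : tens := tpi (trepr x ++ trepr y).
Definition tens_opp (x : tens) : tens :=
  tpi [seq (- p.1, p.2) | p <- trepr x].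

Lemma tens_add_pi s t :
  tens_add (tpi s) (tpi t) = tpi (s ++ t).
Proof. by apply/tens_eqP/TCat; apply: tens_reprP. Qed.

Lemma tens_addA : associative tens_add.
Proof.
move=> x y z; rewrite -[x]treprK -[y]treprK -[z]treprK.
by rewrite !tens_add_pi catA.
Qed.

Lemma tens_addC : commutative tens_add.
Proof.
move=> x y; rewrite -[x]treprK -[y]treprK !tens_add_pi.
exact/tens_eqP/TComm.
Qed.

Lemma tens_add0 : left_id tens_zero tens_add.
Proof. by move=> x; rewrite -[x]treprK tens_add_pi. Qed.

Lemma tens_addN : left_inverse tens_zero tens_opp tens_add.
Proof.
move=> x; rewrite -{2}[x]treprK tens_add_pi; apply/tens_eqP.
elim: (trepr x) => [|[m n] s IHs] /=; first exact: TRefl.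
apply: (TTrans (TComm (_ :: _) (_ :: _))).
apply: (TTrans (t := [:: (m, n); (- m, n)] ++ ([seq (- p.1, p.2) | p <- s] ++ s))).
  rewrite -cat1s -catA /= -(cat1s (m, n)) -(cat1s (- m, n)) -(cat1s (m, n) (_ :: _)).
  rewrite -cat1s.
  apply: TCat; first exact: TRefl.
  apply: (TTrans (TComm _ _)); rewrite cat_cons; exact: TRefl.
rewrite -[[::]]/([::] ++ [::]); apply: TCat => //.
apply: (TTrans (TSym (TAddl _ _ _))); rewrite subrr; exact: TZero.
Qed.

HB.instance Definition _ :=
  GRing.isZmodule.Build tens tens_addA tens_addC tens_add0 tens_addN.

Definition pure (m : M) (n : N) : tens := tpi [:: (m, n)].

Lemma pureDl m m' n : pure (m + m') n = pure m n + pure m' n.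
Proof. by rewrite [RHS]tens_add_pi; apply/tens_eqP/TAddl. Qed.

Lemma pureDr m n n' : pure m (n + n') = pure m n + pure m n'.
Proof. by rewrite [RHS]tens_add_pi; apply/tens_eqP/TAddr. Qed.

Lemma pure_bal m a n : pure (r m a) n = pure m (l a n).
Proof. exact/tens_eqP/TBal. Qed.

Lemma tensE (x : tens) : x = \sum_(p <- trepr x) pure p.1 p.2.
Proof.
rewrite -{1}[x]treprK; elim: (trepr x) => [|[m n] s IHs]; first by rewrite big_nil.
by rewrite big_cons /= -IHs [RHS]tens_add_pi.
Qed.

Lemma tens_ind (Q : tens -> Prop) :
  Q 0 -> (forall x y, Q x -> Q y -> Q (x + y)) ->
  (forall m n, Q (pure m n)) -> forall x, Q x.
Proof. by move=> Q0 QD Qp x; rewrite (tensE x); apply: big_ind. Qed.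

Record balanced (W : zmodType) (f : M -> N -> W) : Prop := Balanced {
  balancedDl : forall m m' n, f (m + m') n = f m n + f m' n;
  balancedDr : forall m n n', f m (n + n') = f m n + f m n';
  balancedZ : forall m a n, f (r m a) n = f m (l a n) }.

(* The additive map induced by [f]; it is total, and it is the map
   m (x) n |-> f m n exactly when [f] is balanced (lemma [tliftE]). *)
Definition tlift (W : zmodType) (f : M -> N -> W) (x : tens) : W :=
  \sum_(p <- trepr x) f p.1 p.2.

Section Lift.
Variables (W : zmodType) (f : M -> N -> W).
Hypothesis fbal : balanced f.

Lemma tlift_pi s : tlift f (tpi s) = \sum_(p <- s) f p.1 p.2.
Proof.
have [fDl fDr fZ] := fbal.
rewrite /tlift; move: (trepr _) (tens_reprP s) => t.
elim=> {s t} //=.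
- by move=> t s u _ -> _ ->.
- by move=> s s' t t' _ e _ e'; rewrite !big_cat /= e e'.
- by move=> s t; rewrite !big_cat /= addrC.
- move=> n; rewrite big_seq1 big_nil /=.
  by apply: (addrI (f 0 n)); rewrite -fDl !addr0.
- by move=> m m' n; rewrite !(big_cons, big_nil) /= !addr0 fDl.
- by move=> m n n'; rewrite !(big_cons, big_nil) /= !addr0 fDr.
- by move=> m a n; rewrite !big_seq1 /= fZ.
Qed.

Lemma tliftE m n : tlift f (pure m n) = f m n.
Proof. by rewrite tlift_pi big_seq1. Qed.

Lemma tliftD x y : tlift f (x + y) = tlift f x + tlift f y.
Proof.
rewrite -[x]treprK -[y]treprK.
by rewrite [_ + _]tens_add_pi !tlift_pi big_cat.
Qed.

Lemma tlift0 : tlift f 0 = 0.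
Proof. by apply: (addrI (tlift f 0)); rewrite -tliftD !addr0. Qed.

End Lift.

Lemma eq_tlift (W : zmodType) (f g : M -> N -> W) :
  (forall m n, f m n = g m n) -> tlift f =1 tlift g.
Proof. by move=> fg x; apply: eq_bigr. Qed.

Lemma tlift_addfun (W : zmodType) (f g : M -> N -> W) x :
  tlift (fun m n => f m n + g m n) x = tlift f x + tlift g x.
Proof. exact: big_split. Qed.

Lemma pure_balanced : balanced pure.
Proof. by split; [exact: pureDl | exact: pureDr | exact: pure_bal]. Qed.

End Tensor.

Section ConverseAlgebra.
Variables (k : fieldType) (A : algType k).

HB.instance Definition _ := GRing.Lmodule.copy A^c A.

Lemma conv_scalerAl (a : k) (x y : A^c) :
  a *: (x * y : A^c) = @GRing.mul A^c (a *: x) y.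
Proof. exact: (@scalerAr k A a y x). Qed.

Lemma conv_scalerAr (a : k) (x y : A^c) :
  a *: (x * y : A^c) = @GRing.mul A^c x (a *: y).
Proof. exact: (@scalerAl k A a y x). Qed.

HB.instance Definition _ := GRing.Lmodule_isLalgebra.Build k A^c conv_scalerAl.
HB.instance Definition _ := GRing.Lalgebra_isAlgebra.Build k A^c conv_scalerAr.

End ConverseAlgebra.

Definition tensk (k : fieldType) (U V : lmodType k) :=
  tens (fun (u : U) (a : k) => a *: u) (fun (a : k) (v : V) => a *: v).
HB.instance Definition _ (k : fieldType) (U V : lmodType k) :=
  GRing.Zmodule.on (tensk U V).

Definition purek (k : fieldType) (U V : lmodType k) (u : U) (v : V) :
  tensk U V := pure _ _ u v.

Notation "U ⊗ V" := (tensk U V)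
  (at level 40, left associativity) : type_scope.
Notation "u ⊗ v" := (purek u v)
  (at level 40, left associativity) : ring_scope.

Definition bilinear_map (k : fieldType) (U V W : lmodType k)
    (f : U -> V -> W) : Prop :=
  (forall v, linear (f^~ v)) /\ (forall u, linear (f u)).

Section TensorOverField.
Variables (k : fieldType) (U V : lmodType k).
Implicit Types (W : lmodType k).

Lemma bilinear_balanced W (f : U -> V -> W) : bilinear_map f ->
  balanced (fun (u : U) (a : k) => a *: u) (fun (a : k) (v : V) => a *: v) f.
Proof.
move=> [fl fr]; split=> [u u' v|u v v'|u a v].
- by have := fl v 1 u u'; rewrite !scale1r.
- by have := fr u 1 v v'; rewrite !scale1r.
- have f0v : f 0 v = 0 by have := fl v (-1) 0 0; rewrite scaler0 addr0 scaleN1r addNr.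
  have fu0 : f u 0 = 0 by have := fr u (-1) 0 0; rewrite scaler0 addr0 scaleN1r addNr.
  have := fl v a u 0; have := fr u a v 0.
  by rewrite !addr0 f0v fu0 !addr0 => -> ->.
Qed.

Lemma purekDl (u u' : U) (v : V) : (u + u') ⊗ v = u ⊗ v + u' ⊗ v.
Proof. exact: pureDl. Qed.

Lemma purekDr (u : U) (v v' : V) : u ⊗ (v + v') = u ⊗ v + u ⊗ v'.
Proof. exact: pureDr. Qed.

Lemma purek_bal (a : k) (u : U) (v : V) : (a *: u) ⊗ v = u ⊗ (a *: v).
Proof. exact: pure_bal. Qed.

Definition tensk_scale (a : k) (x : U ⊗ V) : U ⊗ V :=
  tlift (fun (u : U) (v : V) => (a *: u) ⊗ v) x.

Lemma tensk_scale_balanced (a : k) :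
  balanced (fun (u : U) (b : k) => b *: u) (fun (b : k) (v : V) => b *: v)
    (fun (u : U) (v : V) => (a *: u) ⊗ v).
Proof.
split=> *; rewrite ?scalerDr ?purekDl ?purekDr //.
by rewrite -purek_bal !scalerA mulrC.
Qed.

Lemma tensk_scale_pure a u v : tensk_scale a (u ⊗ v) = (a *: u) ⊗ v.
Proof. exact: tliftE (tensk_scale_balanced a) _ _. Qed.

Lemma tensk_scaleDr a : {morph tensk_scale a : x y / x + y}.
Proof. by move=> x y; exact: tliftD (tensk_scale_balanced a) _ _. Qed.

Lemma tensk_scale0 a : tensk_scale a 0 = 0.
Proof. exact: tlift0 (tensk_scale_balanced a). Qed.

Lemma tensk_ind (Q : U ⊗ V -> Prop) :
  Q 0 -> (forall x y, Q x -> Q y -> Q (x + y)) ->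
  (forall u v, Q (u ⊗ v)) -> forall x, Q x.
Proof. exact: tens_ind. Qed.

Lemma tensk_scaleA a b x :
  tensk_scale a (tensk_scale b x) = tensk_scale (a * b) x.
Proof.
elim/tensk_ind: x => [|x y ex ey|u v]; first by rewrite !tensk_scale0.
- by rewrite !tensk_scaleDr ex ey.
- by rewrite !tensk_scale_pure scalerA.
Qed.

Lemma tensk_scale1 : left_id 1 tensk_scale.
Proof.
elim/tensk_ind=> [|x y ex ey|u v]; first exact: tensk_scale0.
- by rewrite tensk_scaleDr ex ey.
- by rewrite tensk_scale_pure scale1r.
Qed.

Lemma tensk_scaleDl x : {morph tensk_scale^~ x : a b / a + b}.
Proof.
move=> a b; elim/tensk_ind: x => [|x y ex ey|u v] /=.
- by rewrite !tensk_scale0 addr0.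
- by rewrite !tensk_scaleDr ex ey addrACA.
- by rewrite !tensk_scale_pure scalerDl purekDl.
Qed.

HB.instance Definition _ := GRing.Zmodule_isLmodule.Build k (U ⊗ V)%type
  tensk_scaleA tensk_scale1 tensk_scaleDr tensk_scaleDl.

Lemma scale_pureE (a : k) (u : U) (v : V) : a *: (u ⊗ v) = (a *: u) ⊗ v.
Proof. exact: tensk_scale_pure. Qed.

Definition klift W (f : U -> V -> W) : U ⊗ V -> W := tlift f.

Section KLift.
Variables (W : lmodType k) (f : U -> V -> W).
Hypothesis fbil : bilinear_map f.
Let fbal := bilinear_balanced fbil.

Lemma kliftE (u : U) (v : V) : klift f (u ⊗ v) = f u v.
Proof. exact: tliftE fbal _ _. Qed.

Lemma kliftD x y : klift f (x + y) = klift f x + klift f y.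
Proof. exact: tliftD fbal _ _. Qed.

Lemma klift0 : klift f 0 = 0.
Proof. exact: tlift0 fbal. Qed.

Lemma klift_linear : linear (klift f).
Proof.
move=> a x y; rewrite kliftD; congr (_ + _).
elim/tensk_ind: x => [|x x' ex ex'|u v]; first by rewrite scaler0 klift0 scaler0.
- by rewrite scalerDr !kliftD ex ex' scalerDr.
- rewrite scale_pureE !kliftE; have [fl _] := fbil.
  have f0v : f 0 v = 0.
    by have := fl v (-1) 0 0; rewrite scaler0 addr0 scaleN1r addNr.
  by have := fl v a u 0; rewrite !addr0 f0v addr0.
Qed.

End KLift.

Lemma eq_klift W (f g : U -> V -> W) :
  (forall u v, f u v = g u v) -> klift f =1 klift g.
Proof. exact: eq_tlift. Qed.

Lemma klift_scaleadd W (f g : U -> V -> W) (a : k) x :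
  klift (fun u v => a *: f u v + g u v) x = a *: klift f x + klift g x.
Proof.
rewrite /klift tlift_addfun; congr (_ + _).
by rewrite /tlift scaler_sumr.
Qed.

Lemma purek_bilinear : bilinear_map (fun (u : U) (v : V) => u ⊗ v).
Proof.
split=> [v a u u'|u a v v']; first by rewrite purekDl scale_pureE.
by rewrite purekDr scale_pureE purek_bal.
Qed.

End TensorOverField.

(* Equality of linear maps on U ⊗ V can be tested on pure tensors. *)
Lemma tensk_ext (k : fieldType) (U V W : lmodType k) (f g : U ⊗ V -> W) :
  linear f -> linear g -> (forall u v, f (u ⊗ v) = g (u ⊗ v)) -> f =1 g.
Proof.
have D (h : U ⊗ V -> W) : linear h -> forall x y, h (x + y) = h x + h y.
  by move=> lh x y; have := lh 1 x y; rewrite !scale1r.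
move=> lf lg fg; elim/tensk_ind=> [|x y ex ey|//].
- have Z (h : U ⊗ V -> W) : linear h -> h 0 = 0.
    by move=> lh; apply: (addrI (h 0)); rewrite -D // !addr0.
  by rewrite !Z.
- by rewrite !D // ex ey.
Qed.

Definition tmap (k : fieldType) (U V U' V' : lmodType k)
    (f : U -> U') (g : V -> V') : U ⊗ V -> U' ⊗ V' :=
  klift (fun u v => f u ⊗ g v).

Definition tassoc (k : fieldType) (U V W : lmodType k) :
    ((U ⊗ V) ⊗ W)%type -> (U ⊗ (V ⊗ W))%type :=
  klift (fun x w => klift (fun u v => u ⊗ (v ⊗ w)) x).

Lemma tmap_bilinear (k : fieldType) (U V U' V' : lmodType k)
    (f : U -> U') (g : V -> V') : linear f -> linear g ->
  bilinear_map (fun u v => f u ⊗ g v).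
Proof.
move=> lf lg; split=> [v a u u'|u a v v'] /=.
  by rewrite lf (proj1 (purek_bilinear _ _)).
by rewrite lg (proj2 (purek_bilinear _ _)).
Qed.

Lemma tmapE (k : fieldType) (U V U' V' : lmodType k) (f : U -> U')
    (g : V -> V') u v :
  linear f -> linear g -> tmap f g (u ⊗ v) = f u ⊗ g v.
Proof. by move=> lf lg; apply: kliftE; apply: tmap_bilinear. Qed.

Lemma nested_bilinear (k : fieldType) (U V U' V' W : lmodType k)
    (f : U -> V -> U' -> V' -> W) :
  (forall u v, bilinear_map (f u v)) ->
  (forall u' v', bilinear_map (fun u v => f u v u' v')) ->
  bilinear_map (fun x y => klift (fun u v => klift (f u v) y) x).
Proof.
move=> f1 f2.
have out (y : U' ⊗ V') : bilinear_map (fun u v => klift (f u v) y).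
  split=> [v a u u'|u a v v'] /=; rewrite -klift_scaleadd; apply: eq_klift => *.
    by rewrite (proj1 (f2 _ _)).
  by rewrite (proj2 (f2 _ _)).
split=> [y|x]; first exact: klift_linear.
move=> a y y' /=; rewrite -klift_scaleadd; apply: eq_klift => u v.
by rewrite klift_linear.
Qed.

Lemma tassoc_bilinear (k : fieldType) (U V W : lmodType k) :
  bilinear_map (fun (x : U ⊗ V) (w : W) => klift (fun u v => u ⊗ (v ⊗ w)) x).
Proof.
have b1 := @purek_bilinear k U (V ⊗ W)%type; have b2 := @purek_bilinear k V W.
split=> [w|x].
- apply: klift_linear; split=> [v|u] a y y' /=; first by rewrite (proj1 b1).
  by rewrite (proj1 b2) (proj2 b1).
- move=> a w w' /=; rewrite -klift_scaleadd; apply: eq_klift => u v.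
  by rewrite (proj2 b2) (proj2 b1).
Qed.

Lemma tassocE (k : fieldType) (U V W : lmodType k) (u : U) (v : V) (w : W) :
  tassoc ((u ⊗ v) ⊗ w) = u ⊗ (v ⊗ w).
Proof.
rewrite /tassoc kliftE; last exact: tassoc_bilinear.
rewrite kliftE //.
have b1 := @purek_bilinear k U (V ⊗ W)%type; have b2 := @purek_bilinear k V W.
split=> [v'|u'] a y y' /=; first by rewrite (proj1 b1).
by rewrite (proj1 b2) (proj2 b1).
Qed.

(* Needed only for 1 ⊗ 1 != 0, as algebras are nonzero in MathComp. *)
Lemma separating_functional (k : fieldType) (V : lmodType k) (x : V) :
  x != 0 -> exists2 l : V -> k^o, linear l & l x = 1.
Proof.
move=> x0.
pose P (W : set V) := ~ W x /\ forall a u v, W u -> W v -> W (a *: u + v).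
have [F FP Ftot|W [[Wx WD] Wmax]] := @Zorn_bigcup V P.
  split=> [[X FX] /(FP _ FX).1 //|a u v [X FX Xu] [Y FY Yv]].
  have [XY|YX] := Ftot _ _ FX FY.
    by exists Y => //; apply: (FP _ FY).2 => //; exact: XY.
  by exists X => //; apply: (FP _ FX).2 => //; exact: YX.
have W0 : W 0.
  apply: contrapT => nW0; apply: (Wmax [set 0]).
    split=> [u Wu|/(_ 0 erefl)//]; case: nW0.
    by have := WD (-1) u u Wu Wu; rewrite scaleN1r addNr.
  split=> [/= e|a u v -> ->]; first by rewrite e eqxx in x0.
  by rewrite scaler0 addr0.
have WZ a u : W u -> W (a *: u).
  by move=> Wu; have := WD a u 0 Wu W0; rewrite addr0.
have ex y : exists a : k^o, W (y - a *: x).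
  apply: contrapT => ny.
  apply: (Wmax [set u | exists w b, W w /\ u = w + b *: y]).
    split=> [u Wu|/(_ y)]; first by exists u, 0; rewrite scale0r addr0.
    have Hy : exists w b, W w /\ y = w + b *: y.
      by exists 0, 1; rewrite scale1r add0r.
    by move=> /(_ Hy) Wy; apply: ny; exists 0; rewrite scale0r subr0.
  split=> [[w [b [Ww xE]]]|a _ _ [w [b [Ww ->]]] [w' [b' [Ww' ->]]]]; last first.
    exists (a *: w + w'), (a * b + b'); split; first exact: WD.
    by rewrite scalerDr scalerA addrACA scalerDl.
  have b0 : b != 0.
    by apply/eqP => b0; apply: Wx; rewrite xE b0 scale0r addr0.
  apply: ny; exists b^-1; rewrite xE scalerDr scalerA mulVf // scale1r.
  by rewrite opprD addrCA subrr addr0 -scaleNr; apply: WZ.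
pose l y : k^o := projT1 (cid (ex y)).
have lP y : W (y - l y *: x) by rewrite /l; case: cid.
have lU y a : W (y - a *: x) -> l y = a.
  move=> Wa; apply: contrapT => /eqP; rewrite -subr_eq0 => n0; apply: Wx.
  have := WZ (l y - a)^-1 _ (WD (-1) _ _ (lP y) Wa).
  rewrite scaleN1r opprB addrA subrK -scalerBl scalerA mulVf //.
  by rewrite scale1r.
exists l => [a u v|]; apply: lU; last by rewrite scale1r subrr.
by rewrite scalerDl opprD addrACA -scalerA -scalerBr; apply: WD; exact: lP.
Qed.

Lemma purek_neq0 (k : fieldType) (U V : lmodType k) (u : U) (v : V) :
  u != 0 -> v != 0 -> u ⊗ v != 0.
Proof.
move=> /separating_functional[l ll lu] /separating_functional[m lm mv].
have lmbil : bilinear_map (fun u v => l u * m v : k^o).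
  split=> [v' a x y|u' a x y] /=; first by rewrite ll mulrDl -mulrA.
  by rewrite lm mulrDr mulrCA.
apply/eqP => uv0; have := kliftE lmbil u v; rewrite uv0 klift0 // lu mv mulr1.
by move/eqP; rewrite eq_sym oner_eq0.
Qed.

Section TensorAlgebra.
Variables (k : fieldType) (A C : algType k).

Definition tensk_mul (x y : A ⊗ C) : A ⊗ C :=
  klift (fun a c => klift (fun a' c' => (a * a') ⊗ (c * c')) y) x.

Lemma mul_bilinear1 (a : A) (c : C) :
  bilinear_map (fun a' c' => (a * a') ⊗ (c * c')).
Proof.
have [bl br] := @purek_bilinear k A C.
by split=> [y|x] t z z' /=; rewrite mulrDr -scalerAr (bl, br).
Qed.

Lemma mul_bilinear2 (a' : A) (c' : C) :
  bilinear_map (fun a c => (a * a') ⊗ (c * c')).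
Proof.
have [bl br] := @purek_bilinear k A C.
by split=> [y|x] t z z' /=; rewrite mulrDl -scalerAl (bl, br).
Qed.

Lemma tensk_mul_bilinear : bilinear_map tensk_mul.
Proof. exact: nested_bilinear mul_bilinear1 mul_bilinear2. Qed.

Lemma tensk_mul_pure a c a' c' :
  tensk_mul (a ⊗ c) (a' ⊗ c') = (a * a') ⊗ (c * c').
Proof.
rewrite /tensk_mul kliftE; first by rewrite kliftE //; exact: mul_bilinear1.
split=> [y|x] t z z' /=; rewrite -klift_scaleadd; apply: eq_klift => u v.
  by rewrite (proj1 (mul_bilinear2 _ _)).
by rewrite (proj2 (mul_bilinear2 _ _)).
Qed.

Lemma tensk_mulDl x y z : tensk_mul (x + y) z = tensk_mul x z + tensk_mul y z.
Proof.
by have := proj1 tensk_mul_bilinear z 1 x y; rewrite !scale1r.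
Qed.

Lemma tensk_mulDr x y z : tensk_mul x (y + z) = tensk_mul x y + tensk_mul x z.
Proof.
by have := proj2 tensk_mul_bilinear x 1 y z; rewrite !scale1r.
Qed.

Lemma tensk_mul0l x : tensk_mul 0 x = 0.
Proof. by apply: (addrI (tensk_mul 0 x)); rewrite -tensk_mulDl !addr0. Qed.

Lemma tensk_mul0r x : tensk_mul x 0 = 0.
Proof. by apply: (addrI (tensk_mul x 0)); rewrite -tensk_mulDr !addr0. Qed.

Lemma tensk_mulA : associative tensk_mul.
Proof.
move=> x y z; elim/tensk_ind: x => [|x x' e e'|a c].
- by rewrite !tensk_mul0l.
- by rewrite !tensk_mulDl e e'.
elim/tensk_ind: y => [|y y' e e'|a' c'].
- by rewrite !(tensk_mul0l, tensk_mul0r).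
- by rewrite !(tensk_mulDl, tensk_mulDr) e e'.
elim/tensk_ind: z => [|z z' e e'|a'' c''].
- by rewrite !tensk_mul0r.
- by rewrite !tensk_mulDr e e'.
by rewrite !tensk_mul_pure !mulrA.
Qed.

Lemma tensk_mul1l : left_id ((1 : A) ⊗ (1 : C)) tensk_mul.
Proof.
elim/tensk_ind=> [|x x' e e'|a c]; first exact: tensk_mul0r.
- by rewrite tensk_mulDr e e'.
- by rewrite tensk_mul_pure !mul1r.
Qed.

Lemma tensk_mul1r : right_id ((1 : A) ⊗ (1 : C)) tensk_mul.
Proof.
elim/tensk_ind=> [|x x' e e'|a c]; first exact: tensk_mul0l.
- by rewrite tensk_mulDl e e'.
- by rewrite tensk_mul_pure !mulr1.
Qed.

Lemma tensk_oner_neq0 : (1 : A) ⊗ (1 : C) != 0.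
Proof. by apply: purek_neq0; exact: oner_neq0. Qed.

HB.instance Definition _ := GRing.Zmodule_isNzRing.Build (A ⊗ C)%type
  tensk_mulA tensk_mul1l tensk_mul1r
  (fun x y z => tensk_mulDl x y z) (fun x y z => tensk_mulDr x y z)
  tensk_oner_neq0.

Lemma tensk_scalerAl (t : k) (x y : A ⊗ C) : t *: (x * y) = t *: x * y.
Proof.
by have := proj1 tensk_mul_bilinear y t x 0; rewrite tensk_mul0l !addr0.
Qed.

Lemma tensk_scalerAr (t : k) (x y : A ⊗ C) : t *: (x * y) = x * (t *: y).
Proof.
by have := proj2 tensk_mul_bilinear x t y 0; rewrite tensk_mul0r !addr0.
Qed.

HB.instance Definition _ :=
  GRing.Lmodule_isLalgebra.Build k (A ⊗ C)%type tensk_scalerAl.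
HB.instance Definition _ :=
  GRing.Lalgebra_isAlgebra.Build k (A ⊗ C)%type tensk_scalerAr.

Lemma purekM (a a' : A) (c c' : C) :
  (a ⊗ c) * (a' ⊗ c') = (a * a') ⊗ (c * c').
Proof. exact: tensk_mul_pure. Qed.

End TensorAlgebra.

Definition alg_map (k : fieldType) (A C : algType k) (f : A -> C) : Prop :=
  [/\ linear f, {morph f : x y / x * y} & f 1 = 1].

Definition alg_aut (k : fieldType) (A : algType k) (f : A -> A) : Prop :=
  alg_map f /\ bijective f.

HB.mixin Record Algebra_isHopf (k : fieldType) H of GRing.Algebra k H := {
  hdelta : H -> H ⊗ H;
  hcounit : H -> k^o;
  hantipode : H -> H;
  hdelta_alg_map : alg_map hdelta;
  hcounit_alg_map : alg_map hcounit;
  hantipode_linear : linear hantipode;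
  hcoassoc : forall h : H,
    tassoc (tmap hdelta idfun (hdelta h)) = tmap idfun hdelta (hdelta h);
  hcounitl : forall h : H,
    klift (fun h1 h2 : H => hcounit h1 *: h2) (hdelta h) = h;
  hcounitr : forall h : H,
    klift (fun h1 h2 : H => hcounit h2 *: h1) (hdelta h) = h;
  hantipodel : forall h : H,
    klift (fun h1 h2 : H => hantipode h1 * h2) (hdelta h) = (hcounit h)%:A;
  hantipoder : forall h : H,
    klift (fun h1 h2 : H => h1 * hantipode h2) (hdelta h) = (hcounit h)%:A }.

#[short(type="hopfAlgType")]
HB.structure Definition HopfAlgebra (k : fieldType) :=
  {H of GRing.Algebra k H & Algebra_isHopf k H}.

HB.mixin Record Algebra_isComodAlgebra (k : fieldType) (H : hopfAlgType k) P
    of GRing.Algebra k P := {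
  coact : P -> P ⊗ H;
  coact_alg_map : alg_map coact;
  coact_coassoc : forall p : P,
    tassoc (tmap coact idfun (coact p)) = tmap idfun hdelta (coact p);
  coact_counit : forall p : P,
    klift (fun (p0 : P) (h : H) => hcounit h *: p0) (coact p) = p }.

#[short(type="comodAlgType")]
HB.structure Definition ComodAlgebra (k : fieldType) (H : hopfAlgType k) :=
  {P of GRing.Algebra k P & Algebra_isComodAlgebra k H P}.

Section Coinvariants.
Variables (k : fieldType) (H : hopfAlgType k) (P : comodAlgType H).

Definition coinv_pred : {pred P} :=
  fun p => `[< coact p = p ⊗ (1 : H) >].

Lemma coinv_subalg : subalg_closed coinv_pred.
Proof.
have [cl cm c1] := @coact_alg_map k H P.
split; first by apply/asboolP; rewrite c1.
- move=> a x y /asboolP ex /asboolP ey; apply/asboolP.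
  by rewrite cl ex ey (proj1 (purek_bilinear _ _)).
- move=> x y /asboolP ex /asboolP ey; apply/asboolP.
  by rewrite cm ex ey purekM mulr1.
Qed.

Record coinv : Type := Coinv { coinv_val :> P; _ : coinv_val \in coinv_pred }.

HB.instance Definition _ := [isSub for coinv_val].
HB.instance Definition _ := [Choice of coinv by <:].
HB.instance Definition _ := GRing.SubChoice_isSubAlgebra.Build k P coinv_pred
  coinv (GRing.subalg_closed_semi coinv_subalg).

End Coinvariants.

(* Exactness at V; the condition does not presuppose g \o f = 0. *)
Definition exact_at (U V W : zmodType) (f : U -> V) (g : V -> W) : Prop :=
  forall v, g v = 0 <-> exists u, f u = v.

(* Right A-modules are left modules over the converse ring A^c; [act] is a left
   A-module structure on N, tensored with on the right over A. *)
Section FaithfullyFlat.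
Variables (A : pzRingType) (N : zmodType) (act : A -> N -> N).

Definition rtens (M : lmodType A^c) :=
  tens (fun (m : M) (a : A) => (a : A^c) *: m) act.
HB.instance Definition _ (M : lmodType A^c) := GRing.Zmodule.on (rtens M).

Definition rtens_map (M M' : lmodType A^c) (f : M -> M') :
    rtens M -> rtens M' :=
  tlift (fun m n => pure _ _ (f m) n).

Definition faithfully_flat : Prop :=
  forall (M1 M2 M3 : lmodType A^c)
    (f : {linear M1 -> M2}) (g : {linear M2 -> M3}),
  exact_at f g <-> exact_at (rtens_map f) (rtens_map g).

End FaithfullyFlat.

Section HopfGalois.
Variables (k : fieldType) (H : hopfAlgType k) (P : comodAlgType H).
Local Notation B := (coinv P).

Definition coinv_act (b : B) (p : P) : P := (b : P) * p.

Definition galois_tens := tens (fun (q : P) (b : B) => q * (b : P)) coinv_act.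
HB.instance Definition _ := GRing.Zmodule.on galois_tens.

Definition galois_map : galois_tens -> P ⊗ H :=
  tlift (fun q p => klift (fun (p0 : P) (h : H) => (q * p0) ⊗ h) (coact p)).

Definition hopf_galois : Prop := bijective galois_map.

(* The inverse of the Galois map at 1 ⊗ h, when there is one. *)
Definition translation (h : H) : galois_tens :=
  xget 0 [set x | galois_map x = (1 : P) ⊗ h].

Definition comod_alg_aut : set (P -> P) :=
  [set F | alg_aut F /\
           forall p, coact (F p) = tmap F idfun (coact p)].

End HopfGalois.

(* L ⊗_B L, for the B-bimodule structure b.X.c = s(b) t(c) X. *)
Section BimoduleTensor.
Variables (k : fieldType) (B L : algType k) (s t : B -> L).

Definition bimod_tens :=
  tens (fun (X : L) (c : B) => t c * X) (fun (b : B) (X : L) => s b * X).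
HB.instance Definition _ := GRing.Zmodule.on bimod_tens.

Definition bimod_pure (X Y : L) : bimod_tens := pure _ _ X Y.

Record left_bisection (sigma : L -> B) : Prop := LeftBisection {
  lbis_linear : linear sigma;
  lbis_unit : sigma 1 = 1;
  lbis_target : forall b X, sigma (t b * X) = sigma X * b;
  lbis_aut : alg_aut (sigma \o s);
  lbis_mulT : forall X Y, sigma (X * Y) = sigma (X * t (sigma Y));
  lbis_mulS : exists phi', [/\ cancel (sigma \o s) phi',
    cancel phi' (sigma \o s)
    & forall X Y, sigma (X * Y) = sigma (X * s (phi' (sigma Y)))] }.

Record right_bisection (sigma : L -> B) : Prop := RightBisection {
  rbis_linear : linear sigma;
  rbis_unit : sigma 1 = 1;
  rbis_source : forall b X, sigma (s b * X) = b * sigma X;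
  rbis_aut : alg_aut (sigma \o t);
  rbis_mulS : forall X Y, sigma (X * Y) = sigma (X * s (sigma Y));
  rbis_mulT : exists psi', [/\ cancel (sigma \o t) psi',
    cancel psi' (sigma \o t)
    & forall X Y, sigma (X * Y) = sigma (X * t (psi' (sigma Y)))] }.

Variable Delta : L -> bimod_tens.

Definition left_bis_mul (sigma eta : L -> B) (X : L) : B :=
  tlift (fun X1 X2 => sigma (s (eta X1) * X2)) (Delta X).

Definition right_bis_mul (sigma eta : L -> B) (X : L) : B :=
  tlift (fun X1 X2 => sigma (t (eta X2) * X1)) (Delta X).

Lemma left_bis_mul_balanced (sigma eta : L -> B) :
  {morph s : b c / b + c} -> {morph s : b c / b * c} ->
  left_bisection sigma -> left_bisection eta ->
  balanced (fun (X : L) (c : B) => t c * X) (fun (b : B) (X : L) => s b * X)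
    (fun X1 X2 => sigma (s (eta X1) * X2)).
Proof.
move=> sD sM [sl _ _ _ _ _] [el _ et _ _ _].
have sgD x y : sigma (x + y) = sigma x + sigma y.
  by have := sl 1 x y; rewrite !scale1r.
have eD x y : eta (x + y) = eta x + eta y.
  by have := el 1 x y; rewrite !scale1r.
split=> *; first by rewrite eD sD mulrDl sgD.
  by rewrite mulrDr sgD.
by rewrite et sM mulrA.
Qed.

Lemma right_bis_mul_balanced (sigma eta : L -> B) :
  {morph t : b c / b + c} -> (forall b c, t (b * c) = t c * t b) ->
  right_bisection sigma -> right_bisection eta ->
  balanced (fun (X : L) (c : B) => t c * X) (fun (b : B) (X : L) => s b * X)
    (fun X1 X2 => sigma (t (eta X2) * X1)).
Proof.
move=> tD tM [sl _ _ _ _ _] [el _ es _ _ _].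
have sgD x y : sigma (x + y) = sigma x + sigma y.
  by have := sl 1 x y; rewrite !scale1r.
have eD x y : eta (x + y) = eta x + eta y.
  by have := el 1 x y; rewrite !scale1r.
split=> *; first by rewrite mulrDr sgD.
  by rewrite eD tD mulrDl sgD.
by rewrite es tM mulrA.
Qed.

End BimoduleTensor.

Section EhresmannSchauenburg.
Variables (k : fieldType) (H : hopfAlgType k) (P : comodAlgType H).
Local Notation B := (coinv P).

(* The multiplication (p ⊗ q)(r ⊗ u) = pr ⊗ uq is that of P ⊗ P^c. *)
Definition PPop : algType k := (P ⊗ P^c)%type.

Definition PPpure (p q : P) : PPop := purek p (q : P^c).

Lemma PPpureM (p q r u : P) : PPpure p q * PPpure r u = PPpure (p * r) (u * q).
Proof. exact: purekM. Qed.

Definition diag_coact2 (x y : P ⊗ H) : PPop ⊗ H :=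
  klift (fun p0 p1 => klift (fun q0 q1 => PPpure p0 q0 ⊗ (p1 * q1)) y) x.

(* p ⊗ q |-> p_(0) ⊗ q_(0) ⊗ p_(1) q_(1) *)
Definition diag_coact : PPop -> PPop ⊗ H :=
  klift (fun (p : P) (q : P^c) => diag_coact2 (coact p) (coact (q : P))).

Lemma PPpure_bilinear : bilinear_map PPpure.
Proof. exact: (@purek_bilinear k P P^c). Qed.

Lemma dc_bil1 (p : P) (h : H) :
  bilinear_map (fun (q0 : P) (q1 : H) => PPpure p q0 ⊗ (h * q1)).
Proof.
have [bl br] := @purek_bilinear k PPop H; have [cl cr] := PPpure_bilinear.
split=> [v|u] a y z /=; first by rewrite cr bl.
by rewrite mulrDr -scalerAr br.
Qed.

Lemma dc_bil2 (q : P) (h : H) :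
  bilinear_map (fun (p0 : P) (p1 : H) => PPpure p0 q ⊗ (p1 * h)).
Proof.
have [bl br] := @purek_bilinear k PPop H; have [cl cr] := PPpure_bilinear.
split=> [v|u] a y z /=; first by rewrite cl bl.
by rewrite mulrDl -scalerAl br.
Qed.

Lemma diag_coact2_bilinear : bilinear_map diag_coact2.
Proof. exact: nested_bilinear dc_bil1 dc_bil2. Qed.

Lemma diag_coact_bilinear :
  bilinear_map (fun (p : P) (q : P^c) => diag_coact2 (coact p) (coact (q : P))).
Proof.
have [cl _ _] := @coact_alg_map k H P; have [bl br] := diag_coact2_bilinear.
split=> [v|u] a y z /=; first by rewrite cl bl.
by rewrite -br; congr (diag_coact2 _ _); exact: (cl a y z).
Qed.

Lemma diag_coact_linear : linear diag_coact.
Proof. exact: klift_linear diag_coact_bilinear. Qed.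

Lemma diag_coactE p q :
  diag_coact (PPpure p q) = diag_coact2 (coact p) (coact q).
Proof. exact: (kliftE diag_coact_bilinear). Qed.

Lemma diag_coact2E p h q g :
  diag_coact2 (p ⊗ h) (q ⊗ g) = PPpure p q ⊗ (h * g).
Proof.
rewrite /diag_coact2 kliftE; first by rewrite kliftE //; exact: dc_bil1.
split=> [y|x] t z z' /=; rewrite -klift_scaleadd; apply: eq_klift => u v.
  by rewrite (proj1 (dc_bil2 _ _)).
by rewrite (proj2 (dc_bil2 _ _)).
Qed.

Definition diag_sandwich (x y : P ⊗ H) (Z : PPop ⊗ H) : PPop ⊗ H :=
  klift (fun p0 p1 => klift (fun q0 q1 =>
    (PPpure p0 q0 ⊗ p1) * Z * ((1 : PPop) ⊗ q1)) y) x.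

Lemma ds_bil1 Z (p : P) (h : H) :
  bilinear_map (fun (q0 : P) (q1 : H) =>
    (PPpure p q0 ⊗ h) * Z * ((1 : PPop) ⊗ q1)).
Proof.
have [bl br] := @purek_bilinear k PPop H; have [cl cr] := PPpure_bilinear.
split=> [v|u] a y z /=; first by rewrite cr bl !mulrDl -!scalerAl.
by rewrite br mulrDr -scalerAr.
Qed.

Lemma ds_bil2 Z (q : P) (h : H) :
  bilinear_map (fun (p0 : P) (p1 : H) =>
    (PPpure p0 q ⊗ p1) * Z * ((1 : PPop) ⊗ h)).
Proof.
have [bl br] := @purek_bilinear k PPop H; have [cl cr] := PPpure_bilinear.
split=> [v|u] a y z /=; first by rewrite cl bl !mulrDl -!scalerAl.
by rewrite br !mulrDl -!scalerAl.
Qed.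

Lemma diag_sandwich_bilinear Z : bilinear_map (fun x y => diag_sandwich x y Z).
Proof. exact: nested_bilinear (ds_bil1 Z) (ds_bil2 Z). Qed.

Lemma diag_sandwich_linear x y : linear (diag_sandwich x y).
Proof.
move=> a Z Z'; rewrite /diag_sandwich -klift_scaleadd; apply: eq_klift => p h.
rewrite -klift_scaleadd; apply: eq_klift => q g.
by rewrite mulrDr mulrDl -scalerAr -scalerAl.
Qed.

Lemma diag_sandwichE p h q g Z :
  diag_sandwich (p ⊗ h) (q ⊗ g) Z =
  (PPpure p q ⊗ h) * Z * ((1 : PPop) ⊗ g).
Proof.
rewrite /diag_sandwich kliftE; first by rewrite kliftE //; exact: ds_bil1.
split=> [y|x] t z z' /=; rewrite -klift_scaleadd; apply: eq_klift => u v.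
  by rewrite (proj1 (ds_bil2 _ _ _)).
by rewrite (proj2 (ds_bil2 _ _ _)).
Qed.

Lemma diag_coact2_ext (W : lmodType k) (f g : P ⊗ H -> P ⊗ H -> W) :
  bilinear_map f -> bilinear_map g ->
  (forall p h q l, f (p ⊗ h) (q ⊗ l) = g (p ⊗ h) (q ⊗ l)) ->
  forall x y, f x y = g x y.
Proof.
move=> [fl fr] [gl gr] fg x y.
apply: (tensk_ext (fl y) (gl y)) => p h /=.
by apply: (tensk_ext (fr _) (gr _)) => q l; exact: fg.
Qed.

Lemma diag_coact2M (x y z w : P ⊗ H) :
  diag_coact2 (x * z) (w * y) = diag_sandwich x y (diag_coact2 z w).
Proof.
have [dl dr] := diag_coact2_bilinear.
have mul2l a (u v c : P ⊗ H) : (a *: u + v) * c = a *: (u * c) + v * c.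
  by rewrite mulrDl scalerAl.
have mul2r a (u v c : P ⊗ H) : c * (a *: u + v) = a *: (c * u) + c * v.
  by rewrite mulrDr scalerAr.
move: x y; apply: diag_coact2_ext; first 1 last.
- exact: diag_sandwich_bilinear.
- move=> p h q l; move: z w; apply: diag_coact2_ext.
  + by split=> [v|u] a c c' /=; rewrite (mul2r, mul2l) (dl, dr).
  + by split=> [v|u] a c c' /=; rewrite (dl, dr) diag_sandwich_linear.
  move=> p' h' q' l'; rewrite !purekM diag_sandwichE !diag_coact2E !purekM.
  by rewrite !mulr1 !mulrA.
- by split=> [v|u] a c c' /=; rewrite (mul2r, mul2l) (dl, dr).
Qed.

Lemma diag_sandwich_pure1 (x y : P ⊗ H) (Z : PPop) :
  diag_sandwich x y (Z ⊗ (1 : H)) = diag_coact2 x y * (Z ⊗ (1 : H)).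
Proof.
have [dl dr] := diag_coact2_bilinear.
move: x y; apply: diag_coact2_ext; first exact: diag_sandwich_bilinear.
  split=> [v|u] a c c' /=; first by rewrite dl mulrDl scalerAl.
  by rewrite dr mulrDl scalerAl.
move=> p h q l; rewrite diag_sandwichE diag_coact2E !purekM.
by rewrite !mulr1.
Qed.

Lemma diag_coactM_coinv (X Y : PPop) :
  diag_coact Y = Y ⊗ (1 : H) ->
  diag_coact (X * Y) = diag_coact X * diag_coact Y.
Proof.
move=> YE.
have [cl cm _] := @coact_alg_map k H P.
have E (p q : P) Z :
    diag_coact (PPpure p q * Z) =
    diag_sandwich (coact p) (coact q) (diag_coact Z).
  move: Z; apply: (@tensk_ext k P P^c) => [a x y|a x y|r u] /=.
  - by rewrite mulrDr -scalerAr diag_coact_linear.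
  - by rewrite diag_coact_linear diag_sandwich_linear.
  rewrite -/(PPpure r u) PPpureM !diag_coactE -diag_coact2M.
  by rewrite !cm.
move: X; apply: (@tensk_ext k P P^c) => [a x y|a x y|p q] /=.
- by rewrite mulrDl -scalerAl diag_coact_linear.
- by rewrite diag_coact_linear mulrDl scalerAl.
by rewrite -/(PPpure p q) E YE diag_sandwich_pure1 diag_coactE.
Qed.

Definition ES_pred : {pred PPop} :=
  fun X => `[< diag_coact X = X ⊗ (1 : H) >].

Lemma ES_subalg : subalg_closed ES_pred.
Proof.
have [_ _ c1] := @coact_alg_map k H P.
split.
- apply/asboolP; rewrite -[1]/(PPpure 1 1) diag_coactE c1.
  by rewrite diag_coact2E mulr1.
- move=> a x y /asboolP ex /asboolP ey; apply/asboolP.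
  by rewrite diag_coact_linear ex ey (proj1 (purek_bilinear _ _)).
- move=> x y /asboolP ex /asboolP ey; apply/asboolP.
  by rewrite diag_coactM_coinv // ex ey purekM mulr1.
Qed.

(* The Ehresmann-Schauenburg algebra L(P,H). *)
Record ES : Type := MkES { ES_val :> PPop; _ : ES_val \in ES_pred }.

HB.instance Definition _ := [isSub for ES_val].
HB.instance Definition _ := [Choice of ES by <:].
HB.instance Definition _ := GRing.SubChoice_isSubAlgebra.Build k PPop ES_pred
  ES (GRing.subalg_closed_semi ES_subalg).

Definition PPop_source (b : B) : PPop := PPpure b 1.
Definition PPop_target (b : B) : PPop := PPpure 1 b.

Lemma coact_coinv (b : B) : coact (b : P) = (b : P) ⊗ (1 : H).
Proof. by case: b => b /= /asboolP. Qed.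

Lemma PPop_source_in b : PPop_source b \in ES_pred.
Proof.
have [_ _ c1] := @coact_alg_map k H P; apply/asboolP.
by rewrite /PPop_source diag_coactE c1 coact_coinv diag_coact2E mulr1.
Qed.

Lemma PPop_target_in b : PPop_target b \in ES_pred.
Proof.
have [_ _ c1] := @coact_alg_map k H P; apply/asboolP.
by rewrite /PPop_target diag_coactE c1 coact_coinv diag_coact2E mulr1.
Qed.

Definition ES_source (b : B) : ES := MkES (PPop_source_in b).
Definition ES_target (b : B) : ES := MkES (PPop_target_in b).

Definition PPop_mul : PPop -> P := klift (fun (p : P) (q : P^c) => p * (q : P)).

Lemma PPop_mul_bilinear : bilinear_map (fun (p : P) (q : P^c) => p * (q : P)).
Proof.
split=> [v a x y|u a x y] /=; first by rewrite mulrDl scalerAl.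
by rewrite scalerAr -mulrDr.
Qed.

Lemma PPop_mulE p q : PPop_mul (PPpure p q) = p * q.
Proof. exact: (kliftE PPop_mul_bilinear). Qed.

Lemma coact_PPop_mul (X : PPop) :
  coact (PPop_mul X) = tmap PPop_mul idfun (diag_coact X).
Proof.
have [cl cm _] := @coact_alg_map k H P.
have ml : linear PPop_mul by exact: klift_linear PPop_mul_bilinear.
have il : linear (@idfun H) by [].
have tl := klift_linear (tmap_bilinear ml il).
move: X; apply: (@tensk_ext k P P^c) => [a x y|a x y|p q] /=.
- by rewrite ml cl.
- by rewrite diag_coact_linear /tmap tl.
rewrite -/(PPpure p q) PPop_mulE cm diag_coactE.
have [dl dr] := diag_coact2_bilinear.
move: (coact p) (coact q); apply: diag_coact2_ext.
- split=> [v|u] a x y /=; first by rewrite mulrDl scalerAl.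
  by rewrite mulrDr scalerAr.
- by split=> [v|u] a x y /=; rewrite (dl, dr) /tmap tl.
by move=> p0 h q0 g; rewrite purekM diag_coact2E tmapE // PPop_mulE.
Qed.

Lemma ES_counit_in (X : ES) : PPop_mul X \in @coinv_pred k H P.
Proof.
case: X => X /= /asboolP XE; apply/asboolP; rewrite coact_PPop_mul XE.
by rewrite tmapE //; exact: klift_linear PPop_mul_bilinear.
Qed.

Definition ES_counit (X : ES) : B := Coinv (ES_counit_in X).

(* The formula p_(0) ⊗ p_(1)^<1> ⊗_B p_(1)^<2> ⊗ q defines a map into
   (P ⊗ P) ⊗_B (P ⊗ P). *)
Definition PPop_coprod : PPop -> bimod_tens PPop_source PPop_target :=
  tlift (fun (p : P) (q : P^c) =>
    tlift (fun (p0 : P) (h : H) =>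
      tlift (fun (x y : P) =>
        bimod_pure PPop_source PPop_target (PPpure p0 x) (PPpure y q))
      (translation P h)) (coact p)).

Definition ES_tens_val :
    bimod_tens ES_source ES_target -> bimod_tens PPop_source PPop_target :=
  tlift (fun X Y : ES => bimod_pure PPop_source PPop_target X Y).

(* The coproduct of X is the element of L ⊗_B L with image [PPop_coprod X] in
   (P ⊗ P) ⊗_B (P ⊗ P). When the extension is faithfully flat Hopf-Galois,
   [ES_tens_val] is injective and this element exists and is unique. *)
Definition ES_coprod (X : ES) : bimod_tens ES_source ES_target :=
  xget 0 [set Y | ES_tens_val Y = PPop_coprod X].

End EhresmannSchauenburg.

Record is_group (T : Type) (G : set T) (op : T -> T -> T) (e : T) : Prop :=
  IsGroup {
  group_closed : forall x y, G x -> G y -> G (op x y);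
  group_id : G e;
  group_assoc : forall x y z, G x -> G y -> G z ->
    op x (op y z) = op (op x y) z;
  group_idl : forall x, G x -> op e x = x;
  group_idr : forall x, G x -> op x e = x;
  group_inv : forall x, G x -> exists y, [/\ G y, op x y = e & op y x = e] }.

Definition group_isomorphic (T1 T2 : Type) (G1 : set T1) (op1 : T1 -> T1 -> T1)
    (e1 : T1) (G2 : set T2) (op2 : T2 -> T2 -> T2) (e2 : T2) : Prop :=
  [/\ is_group G1 op1 e1, is_group G2 op2 e2 &
   exists2 f : T1 -> T2, set_bij G1 G2 f &
     forall x y, G1 x -> G1 y -> f (op1 x y) = op2 (f x) (f y)].

(* Main.v *)
Require Import Defs.
From HB Require Import structures.
From mathcomp Require Import all_boot all_algebra.
From mathcomp Require Import boolp classical_sets functions.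

(** The equivalence is F |-> (p ⊗ q |-> F(p) q) for left bisections and
    F |-> (p ⊗ q |-> p F(q)) for right ones.  That these are bisections is a
    computation with the values on pure tensors; the content is that every
    bisection arises, that F is then invertible, and that the product of
    bisections, defined through the coproduct, becomes composition.

    Everything rests on one statement, a part of the structure theorem of
    relative Hopf modules: if M is a right P-module with a compatible coaction
    of H, then multiplication M^{coH} ⊗_B P -> M is injective
    ([coinv_mul_inj]), and when the coaction is injective the image contains
    every m with m_0 ⊗ m_1 S(m_2) ⊗ m_3 = m_0 ⊗ 1 ⊗ m_1
    ([coinv_mul_preimage]).  Indeed m ⊗ y |-> m y_0 ⊗ y_1
    is a bijection M ⊗_B P -> M ⊗ H because the extension is Galois
    ([module_galois_inj], [module_galois_invK]); composed with the inclusion of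
    M^{coH} ⊗_B P it is the coaction of the product; and M^{coH} ⊗_B P is the
    kernel of M ⊗_B P -> (M ⊗ H) ⊗_B P by flatness.  That identity, which
    coassociativity implies ([untwist_coact]), says that the element of
    M ⊗_B P with image m_0 ⊗ m_1 lies in the kernel.
    The theorem is used three times.

    - For M = P ⊗ P with its diagonal coaction it says L ⊗_B P = P ⊗ P, so
      every element of P ⊗ P is a sum of products X y with X in L, and additive
      maps on P ⊗ P are determined by such products ([PPop_coinv_span]).
      A left bisection sigma therefore extends to P ⊗ P by X y |-> sigma(X) y,
      and F(p) is the value at p ⊗ 1 ([bis_aut]).  Multiplicativity of F comes
      from sigma(XY) = sigma(X t(sigma(Y))), colinearity from that of the
      coaction, with no computation involving the translation map.
    - For M = P on which P acts through F it says B ⊗_B P = P, so F is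
      bijective as soon as its restriction to B is ([comod_alg_map_bij]).
    - For M = P ⊗ P ⊗ P it shows that L ⊗_B L maps onto the coinvariants:
      this holds after tensoring with P, hence before, by faithful flatness
      ([LLcontract_surj]).  The element p ⊗ 1 ⊗ q is coinvariant when p ⊗ q is,
      and an element of L ⊗_B L above it is a coproduct of p ⊗ q
      ([ES_coprodP]).  Evaluating the two products of bisections is then a
      matter of extending the integrand to (P ⊗ P) ⊗_B (P ⊗ P)
      ([ES_coprod_eval]).

    Right bisections are reduced to left ones: if sigma is a right bisection
    and psi = sigma t, then psi^-1 sigma is a left bisection
    ([right_to_left_bisection]).  It comes from some G in Aut_H(P), and sigma
    from G^-1, since psi (G(p) q) = p G^-1(q). *)

Set Implicit Arguments.
Unset Strict Implicit.
Unset Printing Implicit Defensive.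

Import GRing.Theory.
Local Open Scope classical_set_scope.
Local Open Scope ring_scope.

(** * Linear and bilinear maps on tensor products over a field *)

Section LinearMaps.
Variable k : fieldType.
Implicit Types U V W : lmodType k.

Section OneMap.
Variables (U V : lmodType k) (f : U -> V).
Hypothesis lf : linear f.

Lemma linear_add x y : f (x + y) = f x + f y.
Proof. by have := lf 1 x y; rewrite !scale1r. Qed.

Lemma linear_zero : f 0 = 0.
Proof. by apply: (addrI (f 0)); rewrite -linear_add !addr0. Qed.

Lemma linear_scale a x : f (a *: x) = a *: f x.
Proof. by have := lf a x 0; rewrite linear_zero !addr0. Qed.

Lemma linear_opp x : f (- x) = - f x.
Proof. by rewrite -scaleN1r linear_scale scaleN1r. Qed.
End OneMap.

Lemma linear_idfun U : linear (@idfun U).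
Proof. by []. Qed.

Lemma linear_comp U V W (f : V -> W) (g : U -> V) :
  linear f -> linear g -> linear (fun x => f (g x)).
Proof. by move=> lf lg a x y; rewrite lg lf. Qed.

Lemma linear_subfun U V (f g : U -> V) :
  linear f -> linear g -> linear (fun x => f x - g x).
Proof.
by move=> lf lg a x y; rewrite lf lg scalerBr opprD addrACA.
Qed.

Lemma linear_tmap U V U' V' (f : U -> U') (g : V -> V') :
  linear f -> linear g -> linear (tmap f g).
Proof. by move=> lf lg; apply: klift_linear; exact: tmap_bilinear. Qed.

Lemma linear_tassoc U V W : linear (@tassoc k U V W).
Proof. exact: klift_linear (tassoc_bilinear _ _ _). Qed.

Lemma linear_purel U V (v : V) : linear (fun u : U => u ⊗ v).
Proof. by have [l _] := @purek_bilinear k U V; exact: (l v). Qed.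

Lemma linear_purer U V (u : U) : linear (fun v : V => u ⊗ v).
Proof. by have [_ r] := @purek_bilinear k U V; exact: (r u). Qed.

Lemma bilinear_comp2 U V U' V' W (f : U' -> V' -> W) (g : U -> U') (h : V ->
  V') :
  bilinear_map f -> linear g -> linear h ->
    bilinear_map (fun u v => f (g u) (h v)).
Proof.
by move=> [fl fr] lg lh; split=> [v|u] a x y /=; rewrite (lg, lh) (fl, fr).
Qed.

Lemma bilinear_post U V W W' (f : U -> V -> W) (g : W -> W') :
  bilinear_map f -> linear g -> bilinear_map (fun u v => g (f u v)).
Proof.
by move=> [fl fr] lg; split=> [v|u] a x y /=; rewrite (fl, fr) lg.
Qed.

Lemma tensk_ext2 U V U' V' W (f g : U ⊗ V -> U' ⊗ V' -> W) :
  bilinear_map f -> bilinear_map g ->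
  (forall u v u' v', f (u ⊗ v) (u' ⊗ v') = g (u ⊗ v) (u' ⊗ v')) ->
  forall x y, f x y = g x y.
Proof.
move=> [fl fr] [gl gr] fg x y.
apply: (tensk_ext (fl y) (gl y)) => u v /=.
by apply: (tensk_ext (fr _) (gr _)) => u' v'; exact: fg.
Qed.

Lemma bilinear_mul (A : algType k) : bilinear_map (fun x y : A => x * y).
Proof.
by split=> [v|u] a x y /=; rewrite ?(mulrDl, mulrDr) -?(scalerAl, scalerAr).
Qed.

End LinearMaps.

(** * Products of H-valued tensors *)

Section HMul.
Variables (k : fieldType) (H : algType k).

(** With sums understood, hmul beta sends (m ⊗ g, n ⊗ h) to beta(m, n) ⊗ gh.
    The product of P ⊗ H, the diagonal coactions and the compatibility of a
    coaction with an action are all of this form, for various beta. *)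
Definition hmul (M N W : lmodType k) (beta : M -> N -> W)
    (x : M ⊗ H) (y : N ⊗ H) : W ⊗ H :=
  klift (fun m g => klift (fun n h => beta m n ⊗ (g * h)) y) x.

Section OneBeta.
Variables (M N W : lmodType k) (beta : M -> N -> W).
Hypothesis bb : bilinear_map beta.

Let hmul1 (m : M) (g : H) : bilinear_map (fun n h => beta m n ⊗ (g * h)).
Proof.
by split=> [v|u] a x y /=; rewrite ?(bb.2)
  ?mulrDr -?scalerAr ?linear_purel ?linear_purer.
Qed.

Let hmul2 (n : N) (h : H) : bilinear_map (fun m g => beta m n ⊗ (g * h)).
Proof.
by split=> [v|u] a x y /=; rewrite ?(bb.1)
  ?mulrDl -?scalerAl ?linear_purel ?linear_purer.
Qed.

Lemma hmul_bilinear : bilinear_map (hmul beta).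
Proof. exact: nested_bilinear hmul1 hmul2. Qed.

Lemma hmulE m g n h : hmul beta (m ⊗ g) (n ⊗ h) = beta m n ⊗ (g * h).
Proof.
rewrite /hmul kliftE; first by rewrite kliftE //; exact: hmul1.
split=> [y|x] t z z' /=; rewrite -klift_scaleadd; apply: eq_klift => u v.
  by rewrite (proj1 (hmul2 _ _)).
by rewrite (proj2 (hmul2 _ _)).
Qed.

End OneBeta.

(** Whatever M, N and Q multiply, H enters through its associativity. *)
Lemma hmulA (M N Q MN NQ W : lmodType k) (b1 : M -> N -> MN) (b2 : MN -> Q -> W)
    (b3 : N -> Q -> NQ) (b4 : M -> NQ -> W) :
  bilinear_map b1 -> bilinear_map b2 -> bilinear_map b3 -> bilinear_map b4 ->
  (forall m n q, b2 (b1 m n) q = b4 m (b3 n q)) ->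
  forall x y z, hmul b2 (hmul b1 x y) z = hmul b4 x (hmul b3 y z).
Proof.
move=> B1 B2 B3 B4 E x y z.
have [l1 r1] := hmul_bilinear B1; have [l2 r2] := hmul_bilinear B2.
have [l3 r3] := hmul_bilinear B3; have [l4 r4] := hmul_bilinear B4.
apply: (tensk_ext (f := fun x => hmul b2 (hmul b1 x y) z)
                  (g := fun x => hmul b4 x (hmul b3 y z))).
- by apply: (linear_comp (f := (hmul b2)^~ z)) (l1 y).
- exact: l4.
move=> m g; move: y z; apply: tensk_ext2.
- by apply: (bilinear_comp2 (f := hmul b2) (g := hmul b1 (m ⊗ g))
    (h := idfun)) => //; exact: hmul_bilinear.
- by apply: (bilinear_post (f := hmul b3) (g := hmul b4 (m ⊗ g))) => //;
    exact: hmul_bilinear.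
by move=> n h q l; rewrite !hmulE // E mulrA.
Qed.

Lemma hmul_tmapl (M M' N W : lmodType k) (b : M' -> N -> W) (f : M -> M') :
  bilinear_map b -> linear f -> forall x y,
  hmul b (tmap f idfun x) y = hmul (fun m n => b (f m) n) x y.
Proof.
move=> B lf; have B' : bilinear_map (fun m n => b (f m) n).
  exact: (bilinear_comp2 (h := idfun)).
apply: tensk_ext2 => [||m g n h].
- apply: (bilinear_comp2 (f := hmul b) (h := idfun)) => //.
    exact: hmul_bilinear.
  exact: linear_tmap.
- exact: hmul_bilinear.
by rewrite tmapE // !hmulE.
Qed.

Lemma hmul_tmapr (M N' N W : lmodType k) (b : M -> N' -> W) (f : N -> N') :
  bilinear_map b -> linear f -> forall x y,
  hmul b x (tmap f idfun y) = hmul (fun m n => b m (f n)) x y.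
Proof.
move=> B lf; have B' : bilinear_map (fun m n => b m (f n)).
  exact: (bilinear_comp2 (g := idfun)).
apply: tensk_ext2 => [||m g n h].
- apply: (bilinear_comp2 (f := hmul b) (g := idfun)) => //.
    exact: hmul_bilinear.
  exact: linear_tmap.
- exact: hmul_bilinear.
by rewrite tmapE // !hmulE.
Qed.

Lemma tmap_hmul (M N W W' : lmodType k) (b : M -> N -> W) (f : W -> W') :
  bilinear_map b -> linear f -> forall x y,
  tmap f idfun (hmul b x y) = hmul (fun m n => f (b m n)) x y.
Proof.
move=> B lf; have B' := bilinear_post B lf.
apply: tensk_ext2 => [||m g n h].
- by apply: (bilinear_post (f := hmul b));
    [exact: hmul_bilinear | exact: linear_tmap].
- exact: hmul_bilinear.
by rewrite !hmulE // tmapE.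
Qed.

Lemma eq_hmul (M N W : lmodType k) (b b' : M -> N -> W) :
  (forall m n, b m n = b' m n) -> forall x y, hmul b x y = hmul b' x y.
Proof. by move=> e x y; apply: eq_klift => m g; apply: eq_klift => n h;
  rewrite e. Qed.

End HMul.

(** * Right modules and faithful flatness *)

(** Right modules are kept as a bare operation, because the same additive
    group carries several of them (over B through different maps to P). *)
Record right_action (A : pzRingType) (M : zmodType) (r : M -> A -> M) : Prop :=
  RightAction {
  ractDl : forall m m' a, r (m + m') a = r m a + r m' a;
  ractDr : forall m a b, r m (a + b) = r m a + r m b;
  ractM : forall m a b, r m (a * b) = r (r m a) b;
  ract1 : forall m, r m 1 = m }.

Section RightModule.
Variables (A : pzRingType) (M : zmodType) (r : M -> A -> M).
Hypothesis R : right_action r.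
(** Remembering the proof R in the type lets the module structure be inferred
    from it. *)
Definition rmodule : Type := let _ := R in M.
HB.instance Definition _ := GRing.Zmodule.on rmodule.
Definition rmodule_scale (a : A^c) (m : rmodule) : rmodule := r m a.
Lemma rmodule_scaleA a b m :
  rmodule_scale a (rmodule_scale b m) = rmodule_scale (a * b) m.
Proof. exact: esym (ractM R m b a). Qed.
Lemma rmodule_scaleDl m : {morph rmodule_scale^~ m : a b / a + b}.
Proof. exact: ractDr R m. Qed.
HB.instance Definition _ := GRing.Zmodule_isLmodule.Build A^c rmodule
  rmodule_scaleA (ract1 R) (fun a m m' => ractDl R m m' a) rmodule_scaleDl.
End RightModule.

Section Additive.
Variables (U V : zmodType) (f : U -> V).
Hypothesis fD : {morph f : x y / x + y}.
Lemma morph0 : f 0 = 0.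
Proof. by apply: (addrI (f 0)); rewrite -fD !addr0. Qed.
Lemma morphN x : f (- x) = - f x.
Proof. by apply: (addrI (f x)); rewrite -fD !subrr morph0. Qed.
Lemma morph_inj : (forall x, f x = 0 -> x = 0) -> injective f.
Proof.
move=> f0 x y e; apply/eqP; rewrite -subr_eq0; apply/eqP/f0.
by rewrite fD morphN e subrr.
Qed.
End Additive.

Lemma tens_ext (A : Type) (M N W : zmodType) (r : M -> A -> M) (l : A -> N -> N)
    (f g : tens r l -> W) :
  {morph f : x y / x + y} -> {morph g : x y / x + y} ->
  (forall m n, f (pure _ _ m n) = g (pure _ _ m n)) -> f =1 g.
Proof.
move=> fD gD e; elim/tens_ind => [|x y ex ey|//]; first by rewrite !morph0.
by rewrite fD gD ex ey.
Qed.

Section Flatness.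
Variables (A : pzRingType) (N : zmodType) (l : A -> N -> N).

Section TensMap.
Variables (M M' : zmodType) (r : M -> A -> M) (r' : M' -> A -> M').
Variable f : M -> M'.
Definition tensmap : tens r l -> tens r' l := tlift (fun m n => pure _ _ (f
  m) n).
Hypotheses (fD : {morph f : x y / x + y}) (fr : forall m a, f (r m a) =
  r' (f m) a).
Lemma tensmap_balanced : balanced r l (fun m n => pure r' l (f m) n).
Proof.
by split=> *; rewrite ?fD ?fr ?pureDl ?pureDr ?pure_bal.
Qed.
Lemma tensmapE m n : tensmap (pure _ _ m n) = pure _ _ (f m) n.
Proof. exact: tliftE tensmap_balanced _ _. Qed.
Lemma tensmapD : {morph tensmap : x y / x + y}.
Proof. exact: tliftD tensmap_balanced. Qed.
End TensMap.

Lemma faithfully_flat_exact (M1 M2 M3 : zmodType)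
    (r1 : M1 -> A -> M1) (r2 : M2 -> A -> M2) (r3 : M3 -> A -> M3)
    (f : M1 -> M2) (g : M2 -> M3) :
  faithfully_flat l ->
  right_action r1 -> right_action r2 -> right_action r3 ->
  {morph f : x y / x + y} -> (forall m a, f (r1 m a) = r2 (f m) a) ->
  {morph g : x y / x + y} -> (forall m a, g (r2 m a) = r3 (g m) a) ->
  exact_at f g <->
  exact_at (@tensmap M1 M2 r1 r2 f) (@tensmap M2 M3 r2 r3 g).
Proof.
(* The records are destructed so that the module structures built on them have
   the given additive structures up to conversion. *)
destruct M1 as [T1 []], M2 as [T2 []], M3 as [T3 []].
move=> ff R1 R2 R3 fD fr gD gr.
pose L1 : lmodType A^c := rmodule R1.
pose L2 : lmodType A^c := rmodule R2.
pose L3 : lmodType A^c := rmodule R3.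
have lf : linear (f : L1 -> L2).
  by move=> a x y; rewrite fD; congr (_ + _); exact: fr.
have lg : linear (g : L2 -> L3).
  by move=> a x y; rewrite gD; congr (_ + _); exact: gr.
pose F : {linear L1 -> L2} := HB.pack (f : L1 -> L2)
  (GRing.isLinear.Build _ _ _ _ _ lf).
pose G : {linear L2 -> L3} := HB.pack (g : L2 -> L3)
  (GRing.isLinear.Build _ _ _ _ _ lg).
refine (ff L1 L2 L3 F G).
Qed.

Hypothesis ff : faithfully_flat l.

(** Exactness of 0 -> M -> M' with the zero map taken from M itself, which
    avoids a zero module. *)
Lemma flat_injective (M M' : zmodType) (r : M -> A -> M) (r' : M' -> A -> M')
    (f : M -> M') : right_action r -> right_action r' ->
  {morph f : x y / x + y} -> (forall m a, f (r m a) = r' (f m) a) ->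
  injective f -> injective (@tensmap M M' r r' f).
Proof.
move=> R R' fD fr finj.
have zr : forall (m : M) (a : A), (0 : M) = r 0 a.
  by move=> m a; rewrite [RHS](@morph0 _ _ (r^~ a)) // => x y /=;
    rewrite ractDl.
have zD : {morph (fun _ : M => 0 : M) : x y / x + y} by move=> *; rewrite addr0.
have [e _] := @faithfully_flat_exact _ _ _ r r r' (fun=> 0)
  f ff R R R' zD zr fD fr.
apply: morph_inj => [|x fx0]; first exact: tensmapD.
have /e E : exact_at (fun _ : M => 0 : M) f.
  move=> m; split=> [fm|[_ <-]]; last exact: morph0.
  by exists 0; apply: finj; rewrite morph0.
have [u <-] := (E x).1 fx0.
move: u; apply: (tens_ind (Q := fun u => tensmap r (fun=> 0) u = 0)).
- exact: morph0 (tensmapD zD zr).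
- by move=> u v eu ev; rewrite tensmapD // eu ev addr0.
- move=> m n; rewrite tensmapE //.
  by rewrite (@morph0 _ _ (fun m => pure r l m n)) // => ? ? /=; exact: pureDl.
Qed.

(** Exactness of M -> M' -> 0, the zero map going to M' itself. *)
Lemma faithfully_flat_surjective (M M' : zmodType) (r : M -> A -> M)
    (r' : M' -> A -> M') (f : M -> M') : right_action r -> right_action r' ->
  {morph f : x y / x + y} -> (forall m a, f (r m a) = r' (f m) a) ->
  (forall y, exists x, @tensmap M M' r r' f x = y) ->
  forall y, exists x, f x = y.
Proof.
move=> R R' fD fr fsurj.
have zr : forall (m : M') (a : A), (0 : M') = r' 0 a.
  by move=> m a; rewrite [RHS](@morph0 _ _ (r'^~ a)) // => x y /=;
    rewrite ractDl.
have zD : {morph (fun _ : M' => 0 : M') : x y / x + y} by move=> *;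
  rewrite addr0.
have [_ e] := @faithfully_flat_exact _ _ _ r r' r' f (fun=> 0)
  ff R R' R' fD fr zD zr.
move=> y; suff: exact_at f (fun _ : M' => 0 : M') by case/(_ y) => /(_ erefl).
apply: e => v; split=> [_|_]; first exact: fsurj.
move: v; apply: (tens_ind (Q := fun u => tensmap r' (fun=> 0) u = 0)).
- exact: morph0 (tensmapD zD zr).
- by move=> u v eu ev; rewrite tensmapD // eu ev addr0.
- move=> m n; rewrite tensmapE //.
  by rewrite (@morph0 _ _ (fun m => pure r' l m n)) // => ? ? /=; exact: pureDl.
Qed.

End Flatness.

(** * Modules over a Hopf-Galois extension *)

Lemma tensk_ext_additive (k : fieldType) (U V : lmodType k) (W : zmodType)
    (f g : U ⊗ V -> W) :
  {morph f : x y / x + y} -> {morph g : x y / x + y} ->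
  (forall u v, f (u ⊗ v) = g (u ⊗ v)) -> f =1 g.
Proof. exact: tens_ext. Qed.

Record algebra_action (k : fieldType) (A : algType k) (M : lmodType k)
    (act : M -> A -> M) : Prop := AlgebraAction {
  aact_bilinear : bilinear_map act;
  aactM : forall m x y, act m (x * y) = act (act m x) y;
  aact1 : forall m, act m 1 = m }.

Lemma mul_action (k : fieldType) (A : algType k) :
  algebra_action (fun x y : A => x * y).
Proof. by split; [exact: bilinear_mul | exact: mulrA | exact: mulr1]. Qed.

Section GaloisModules.
Variables (k : fieldType) (H : hopfAlgType k) (P : comodAlgType H).
Local Notation B := (coinv P).

Definition coinv_res (M : lmodType k) (act : M -> P -> M) (m : M) (b : B) : M :=
  act m (b : P).

Lemma coinv_res_action (M : lmodType k) (act : M -> P -> M) :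
  algebra_action act -> right_action (coinv_res act).
Proof.
move=> [[al ar] aM a1]; split=> *; rewrite /coinv_res.
- exact: linear_add (al _) _ _.
- exact: linear_add (ar _) _ _.
- exact: aM.
- exact: a1.
Qed.

Lemma coact_coinvM (b : B) (y : P) :
  coact ((b : P) * y) = hmul (fun x y : P => x * y) ((b : P) ⊗ (1 : H))
    (coact y).
Proof. by have [_ -> _] := @coact_alg_map k H P; rewrite coact_coinv. Qed.

Arguments coinv_res {M} act m b.
Section GaloisMap.
Variables (M : lmodType k) (act : M -> P -> M).
Hypothesis Mact : algebra_action act.
Let actB := aact_bilinear Mact.

(** The Galois map with coefficients, m ⊗ y |-> m y_0 ⊗ y_1, for a right
    P-module M. *)
Definition module_galois : tens (coinv_res act) (@coinv_act k H P) -> M ⊗ H :=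
  tlift (fun m y => hmul act (m ⊗ (1 : H)) (coact y)).

Lemma hmul_actA (m : M) (x : P) (w : P ⊗ H) :
  hmul act (m ⊗ (1 : H)) (hmul (fun x y : P => x * y) (x ⊗ (1 : H)) w) =
  hmul act (act m x ⊗ (1 : H)) w.
Proof.
rewrite -(hmulA (b1 := act) (b2 := act)) //.
- by rewrite hmulE // mulr1.
- exact: bilinear_mul.
- by move=> *; rewrite (aactM Mact).
Qed.

Lemma module_galois_balanced : balanced (coinv_res act) (@coinv_act k H P)
  (fun m y => hmul act (m ⊗ (1 : H)) (coact y)).
Proof.
have [hl hr] := hmul_bilinear H actB; have [cl _ _] := @coact_alg_map k H P.
split=> *.
- by rewrite purekDl; exact: linear_add (hl _) _ _.
- by rewrite (linear_add cl); exact: linear_add (hr _) _ _.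
- by rewrite coact_coinvM hmul_actA.
Qed.

Lemma module_galoisE m y : module_galois (pure _ _ m y) =
  hmul act (m ⊗ (1 : H)) (coact y).
Proof. exact: tliftE module_galois_balanced _ _. Qed.

Lemma module_galoisD : {morph module_galois : x y / x + y}.
Proof. exact: tliftD module_galois_balanced. Qed.

(** n.(q ⊗ p) = nq ⊗ p, which transports facts about P ⊗_B P to M ⊗_B P. *)
Definition galois_act (n : M) :
    galois_tens P -> tens (coinv_res act) (@coinv_act k H P) :=
  tlift (fun q p => pure _ _ (act n q) p).

Lemma galois_act_balanced n :
  balanced (fun (q : P) (b : B) => q * (b : P)) (@coinv_act k H P)
    (fun q p => pure (coinv_res act) (@coinv_act k H P) (act n q) p).
Proof.
split=> *.
- by rewrite (linear_add (actB.2 _)) pureDl.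
- by rewrite pureDr.
- by rewrite (aactM Mact) -pure_bal.
Qed.

Lemma galois_actE n q p : galois_act n (pure _ _ q p) = pure _ _ (act n q) p.
Proof. exact: tliftE (galois_act_balanced n) _ _. Qed.

Lemma galois_actD n : {morph galois_act n : x y / x + y}.
Proof. exact: tliftD (galois_act_balanced n). Qed.

Lemma galois_actDl n n' z : galois_act (n + n') z =
  galois_act n z + galois_act n' z.
Proof.
rewrite -[RHS]tlift_addfun; apply: eq_tlift => q p.
by rewrite (linear_add (actB.1 _)) pureDl.
Qed.
End GaloisMap.
Arguments module_galois {M} act _.

Notation module_galoisP := (module_galois (fun x y : P => x * y)).
Notation galois_actP := (galois_act (fun x y : P => x * y)).

Lemma galois_mapE z : galois_map z = module_galoisP z.
Proof.
apply: eq_tlift => q p; move: (coact p); apply: tensk_ext.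
- apply: klift_linear; split=> [v|u] a x y /=.
    by rewrite mulrDr -scalerAr linear_purel.
  by rewrite linear_purer.
- have [_ r] := hmul_bilinear H (@bilinear_mul k P); exact: r.
move=> x h; rewrite hmulE; last exact: bilinear_mul.
rewrite mul1r kliftE //; split=> [v|u] a y z' /=.
  by rewrite mulrDr -scalerAr linear_purel.
by rewrite linear_purer.
Qed.

Section Mixed.
Variables (M : lmodType k) (act : M -> P -> M).
Hypothesis Mact : algebra_action act.
Let actB := aact_bilinear Mact.
Let mulP := mul_action P.

Lemma module_galois_act n z :
  module_galois act (galois_act act n z) =
    hmul act (n ⊗ (1 : H)) (module_galoisP z).
Proof.
have [hl hr] := hmul_bilinear H actB.
move: z; apply: tens_ext => [x y|x y|q p].
- by rewrite galois_actD // module_galoisD.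
- by rewrite module_galoisD // (linear_add (hr _)).
- by rewrite galois_actE // !module_galoisE // hmul_actA.
Qed.

Lemma galois_actA n y z :
  galois_act act n (galois_actP y z) = galois_act act (act n y) z.
Proof.
move: z; apply: tens_ext => [u v|u v|q p].
- by rewrite galois_actD // galois_actD.
- by rewrite galois_actD.
- by rewrite !galois_actE // (aactM Mact).
Qed.
End Mixed.

Hypothesis galP : hopf_galois P.

Lemma galois_mapP_inj : injective module_galoisP.
Proof. by move=> x y; rewrite -!galois_mapE; exact: bij_inj. Qed.

Lemma translationE h : module_galoisP (translation P h) = (1 : P) ⊗ h.
Proof.
rewrite -galois_mapE; case: galP => g _ gK.
by have := @xgetPex _ 0 [set x | galois_map x =
  (1 : P) ⊗ h] (ex_intro _ _ (gK _)).
Qed.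

Let mulP := mul_action P.

Lemma translationD h h' :
  translation P (h + h') = translation P h + translation P h'.
Proof. by apply: galois_mapP_inj;
  rewrite module_galoisD // !translationE purekDr. Qed.

(** The k-module P ⊗_B P is only an additive group here, so that scalars act
    through P. *)
Lemma translationZ a h :
  translation P (a *: h) = galois_actP (a%:A : P) (translation P h).
Proof.
apply: galois_mapP_inj; rewrite module_galois_act // !translationE.
rewrite hmulE; last exact: bilinear_mul.
by rewrite mulr1 mul1r purek_bal.
Qed.

Section Inverse.
Variables (M : lmodType k) (act : M -> P -> M).
Hypothesis Mact : algebra_action act.
Let actB := aact_bilinear Mact.

(** n ⊗ h |-> n h^<1> ⊗ h^<2>. *)
Definition module_galois_inv : M ⊗ H ->
  tens (coinv_res act) (@coinv_act k H P) :=
  tlift (fun n h => galois_act act n (translation P h)).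

Lemma module_galois_inv_balanced :
  balanced (fun (u : M) (a : k) => a *: u) (fun (a : k) (v : H) => a *: v)
    (fun n h => galois_act act n (translation P h)).
Proof.
split=> *; first exact: galois_actDl.
  by rewrite translationD galois_actD.
rewrite translationZ galois_actA // (linear_scale (actB.2 _)).
by rewrite (aact1 Mact).
Qed.

Lemma module_galois_invE n h :
  module_galois_inv (n ⊗ h) = galois_act act n (translation P h).
Proof. exact: tliftE module_galois_inv_balanced _ _. Qed.

Lemma module_galois_invD : {morph module_galois_inv : x y / x + y}.
Proof. exact: tliftD module_galois_inv_balanced. Qed.

Lemma module_galois_invK : cancel module_galois_inv (module_galois act).
Proof.
apply: tensk_ext_additive => [x y|//|n h].
  by rewrite module_galois_invD module_galoisD.
rewrite module_galois_invE module_galois_act // translationE hmulE //.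
by rewrite (aact1 Mact) mul1r.
Qed.
End Inverse.
Arguments module_galois_inv {M} act _.

(** The case of general M reduces to M = P by n.(-), and there the identity is
    y_0 y_1^<1> ⊗ y_1^<2> = 1 ⊗ y, which holds since both sides have the same
    image under the Galois map. *)
Lemma module_galoisK (M : lmodType k) (act : M -> P ->
  M) : algebra_action act ->
  cancel (module_galois act) (module_galois_inv act).
Proof.
move=> Mact; have actB := aact_bilinear Mact.
have [hl hr] := hmul_bilinear H actB.
apply: tens_ext => [x y|//|m y];
  first by rewrite module_galoisD // module_galois_invD.
rewrite module_galoisE //.
have -> w : module_galois_inv act (hmul act (m ⊗ (1 : H)) w) =
    galois_act act m (module_galois_inv (fun x y : P => x * y) w).
  move: w; apply: tensk_ext_additive => [u v|u v|x h].
  - by rewrite (linear_add (hr _)) module_galois_invD.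
  - by rewrite module_galois_invD // galois_actD.
  - by rewrite hmulE // mul1r !module_galois_invE // galois_actA.
have -> : module_galois_inv (fun x y : P => x * y) (coact y) = pure _ _ 1 y.
  apply: galois_mapP_inj; rewrite module_galois_invK // module_galoisE //;
    move: (coact y).
  have [hl' hr'] := hmul_bilinear H (@bilinear_mul k P).
  apply: tensk_ext => // x h; rewrite hmulE ?mul1r //; exact: bilinear_mul.
by rewrite galois_actE // (aact1 Mact).
Qed.

Lemma module_galois_inj (M : lmodType k) (act : M -> P ->
  M) : algebra_action act ->
  injective (module_galois act).
Proof. by move=> Mact; exact: can_inj (module_galoisK Mact). Qed.

End GaloisModules.
Arguments module_galois {k H P M} act _.
Arguments module_galois_inv {k H P M} act _.
Arguments coinv_res {k H P M} act m b.

(** * The antipode of a comodule *)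

Section Untwist.
Variables (k : fieldType) (H : hopfAlgType k).

Definition mulHr (N : lmodType k) (x : N ⊗ H) (g : H) : N ⊗ H :=
  klift (fun n h => n ⊗ (h * g)) x.

Lemma mulHr_pre_bilinear (N : lmodType k) (g : H) :
  bilinear_map (fun (n : N) h => n ⊗ (h * g)).
Proof.
split=> [v|u] a x y /=; first by rewrite linear_purel.
by rewrite mulrDl -scalerAl linear_purer.
Qed.

Lemma mulHr_bilinear (N : lmodType k) : bilinear_map (@mulHr N).
Proof.
split=> [g|x]; first exact/klift_linear/mulHr_pre_bilinear.
move=> a g g'; rewrite /mulHr -klift_scaleadd; apply: eq_klift => n h.
by rewrite mulrDr -scalerAr linear_purer.
Qed.

Lemma mulHrE (N : lmodType k) (n : N) h g : mulHr (n ⊗ h) g = n ⊗ (h * g).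
Proof. exact: (kliftE (mulHr_pre_bilinear _ _)). Qed.

Lemma mulHr_hmul (M N W : lmodType k) (b : M -> N -> W) : bilinear_map b ->
  forall x y g, mulHr (hmul b x y) g = hmul b x (mulHr y g).
Proof.
move=> B x y g; have HB := hmul_bilinear H B.
move: x y; apply: tensk_ext2.
- by apply: (bilinear_post (f := hmul b) (g := fun x => mulHr x g)) => //;
    exact: (mulHr_bilinear _).1.
- by apply: (bilinear_comp2 (f := hmul b) (g := idfun)
    (h := fun x => mulHr x g)) => //; exact: (mulHr_bilinear _).1.
by move=> m h n h'; rewrite mulHrE !hmulE // mulHrE mulrA.
Qed.

Lemma tmap_mulHr (N N' : lmodType k) (f : N -> N') : linear f ->
  forall x g, tmap f idfun (mulHr x g) = mulHr (tmap f idfun x) g.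
Proof.
move=> lf x g; have lg N0 := (@mulHr_bilinear N0).1 g.
have lt := linear_tmap lf (@linear_idfun k H).
move: x; apply: tensk_ext.
- exact: (linear_comp (f := tmap f idfun) (g := fun x => mulHr x g)).
- exact: (linear_comp (g := tmap f idfun) (f := fun x => mulHr x g)).
by move=> n h /=; rewrite mulHrE !tmapE // mulHrE.
Qed.

Section Comodule.
Variables (N : lmodType k) (rho : N -> N ⊗ H).
Hypothesis lrho : linear rho.

(** n ⊗ h |-> n_0 ⊗ n_1 S(h_1) ⊗ h_2. On a coaction n_0 ⊗ n_1 the antipode
    cancels and n_0 ⊗ 1 ⊗ n_1 remains ([untwist_coact]). This is what tells,
    in terms of the image of M ⊗_B P in M ⊗ H, whether the coaction and m |->
    m ⊗ 1 agree on the first factor. *)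
Definition untwist : N ⊗ H -> ((N ⊗ H) ⊗ H)%type :=
  klift (fun n h =>
    klift (fun h1 h2 => mulHr (rho n) (hantipode h1) ⊗ h2) (hdelta h)).

Lemma untwist_pre1 n :
  bilinear_map (fun h1 h2 : H => mulHr (rho n) (hantipode h1) ⊗ h2).
Proof.
split=> [v|u] a x y /=; last by rewrite linear_purer.
by rewrite hantipode_linear (mulHr_bilinear _).2 linear_purel.
Qed.

Lemma untwist_pre : bilinear_map (fun n h =>
    klift (fun h1 h2 => mulHr (rho n) (hantipode h1) ⊗ h2) (hdelta h)).
Proof.
split=> [h|n] a x y /=.
- rewrite -klift_scaleadd; apply: eq_klift => h1 h2.
  by rewrite lrho (mulHr_bilinear _).1 linear_purel.
- have [-> _ _] := @hdelta_alg_map k H.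
  exact/klift_linear/untwist_pre1.
Qed.

Lemma untwist_linear : linear untwist.
Proof. exact: klift_linear untwist_pre. Qed.

Lemma untwistE n h : untwist (n ⊗ h) =
  klift (fun h1 h2 => mulHr (rho n) (hantipode h1) ⊗ h2) (hdelta h).
Proof. exact: kliftE untwist_pre _ _. Qed.

Definition insert1 : N ⊗ H -> ((N ⊗ H)
  ⊗ H)%type := tmap (fun n => n ⊗ (1 : H)) idfun.

Lemma insert1_linear : linear insert1.
Proof. by apply: linear_tmap => //; exact: linear_purel. Qed.

Lemma insert1E n h : insert1 (n ⊗ h) = (n ⊗ (1 : H)) ⊗ h.
Proof. by apply: tmapE => //; exact: linear_purel. Qed.

End Comodule.

(** g ⊗ (a ⊗ b) |-> g S(a) ⊗ b. *)
Definition antipode_conv : (H ⊗ (H ⊗ H))%type -> H ⊗ H :=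
  klift (fun g w => klift (fun a b => (g * hantipode a) ⊗ b) w).

Lemma antipode_conv_pre1 g :
  bilinear_map (fun a b : H => (g * hantipode a) ⊗ b).
Proof.
split=> [v|u] a x y /=; last by rewrite linear_purer.
by rewrite hantipode_linear mulrDr -scalerAr linear_purel.
Qed.

Lemma antipode_conv_pre :
  bilinear_map (fun (g : H) (w : H ⊗ H) =>
    klift (fun a b : H => (g * hantipode a) ⊗ b) w).
Proof.
split=> [w|g] a x y /=; last exact/klift_linear/antipode_conv_pre1.
rewrite -klift_scaleadd; apply: eq_klift => h1 h2.
by rewrite mulrDl -scalerAl linear_purel.
Qed.

Lemma antipode_convE g w : antipode_conv (g ⊗ w) =
  klift (fun a b : H => (g * hantipode a) ⊗ b) w.
Proof. exact: kliftE antipode_conv_pre _ _. Qed.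

(** h_1 S(h_2) ⊗ h_3 = 1 ⊗ h: coassociativity regroups the first two factors,
    which the antipode turns into the counit. *)
Lemma antipode_conv_delta (h : H) :
  antipode_conv (tmap idfun hdelta (hdelta h)) = 1 ⊗ h.
Proof.
have [ld _ _] := @hdelta_alg_map k H; have [le _ _] := @hcounit_alg_map k H.
have lac : linear antipode_conv by exact: klift_linear antipode_conv_pre.
have cb : bilinear_map (fun h1 h2 : H => h1 * hantipode h2).
  exact: bilinear_comp2 (@bilinear_mul k H) _ (@hantipode_linear k H).
rewrite -hcoassoc.
have -> w : antipode_conv (tassoc w) =
    tmap (klift (fun h1 h2 : H => h1 * hantipode h2)) idfun w.
  move: w; apply: tensk_ext.
  - apply: (linear_comp (f := antipode_conv) (g := @tassoc k H H H)) => //.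
    exact: linear_tassoc.
  - by apply: linear_tmap => //; exact: klift_linear.
  move=> x b; rewrite tmapE //; last exact: klift_linear.
  move: x; apply: tensk_ext.
  - apply: (linear_comp (f := antipode_conv)
      (g := fun x => @tassoc k H H H (x ⊗ b))) => //.
    apply: (linear_comp (f := @tassoc k H H H)); first exact: linear_tassoc.
    exact: linear_purel.
  - apply: (linear_comp (f := fun u : H => u ⊗ b)); first exact: linear_purel.
    exact: klift_linear.
  move=> g a; rewrite tassocE antipode_convE kliftE;
    last exact: antipode_conv_pre1.
  by rewrite (kliftE cb).
have <- : klift (fun h1 h2 : H => (1 : H) ⊗ ((hcounit h1 : k) *: h2 : H))
  (hdelta h) = 1 ⊗ h.
  have sb : bilinear_map (fun h1 h2 : H => (hcounit h1 : k) *: h2 : H).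
    split=> [v|u] a x y /=; last by rewrite scalerDr !scalerA mulrC.
    by rewrite le scalerDl scalerA.
  have sb' := bilinear_post sb (@linear_purer k H H 1).
  rewrite -{2}[h]hcounitl; move: (hdelta h); apply: tensk_ext.
  - exact: klift_linear.
  - apply: (linear_comp (f := fun u : H => (1 : H) ⊗ u));
      first exact: linear_purer.
    exact: klift_linear.
  by move=> x y; rewrite (kliftE sb') (kliftE sb).
have -> : klift (fun h1 h2 : H => (1 : H) ⊗ ((hcounit h1 : k) *: h2 : H))
  (hdelta h) =
    tmap (fun h1 : H => (hcounit h1 : k)%:A : H) idfun (hdelta h).
  by apply: eq_klift => h1 h2; rewrite -purek_bal.
have lA : linear (fun h1 : H => (hcounit h1 : k)%:A : H).
  by move=> a x y; rewrite le scalerDl scalerA.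
move: (hdelta h); apply: tensk_ext.
- apply: (linear_comp (f := tmap (klift (fun h1 h2 : H => h1 * hantipode h2))
    idfun) (g := tmap hdelta idfun)).
    by apply: linear_tmap => //; exact: klift_linear.
  exact: linear_tmap.
- exact: linear_tmap.
by move=> x y; rewrite !tmapE // ?hantipoder //; exact: klift_linear.
Qed.

(** Coassociativity turns the left side into n_0 ⊗ n_1 S(n_2) ⊗ n_3. *)
Lemma untwist_coact (N : lmodType k) (rho : N -> N ⊗ H) : linear rho ->
  (forall n, tassoc (tmap rho idfun (rho n)) = tmap idfun hdelta (rho n)) ->
  forall n, untwist rho (rho n) = insert1 (rho n).
Proof.
move=> lr coas n.
have [ld _ _] := @hdelta_alg_map k H.
have kb1 (m : N) : bilinear_map (fun (a b : H) => (m ⊗ a) ⊗ b).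
  split=> [v|u] a x y /=; last by rewrite linear_purer.
  by rewrite linear_purer linear_purel.
have kb : bilinear_map (fun (m : N) (w : H ⊗ H) =>
    klift (fun (a b : H) => (m ⊗ a) ⊗ b) w).
  split=> [w|m] a x y /=; last exact/klift_linear/kb1.
  rewrite -klift_scaleadd; apply: eq_klift => h1 h2.
  by rewrite !linear_purel.
pose K : (N ⊗ (H ⊗ (H ⊗ H)))%type -> ((N ⊗ H) ⊗ H)%type :=
  klift (fun m w => klift (fun a b => (m ⊗ a) ⊗ b) (antipode_conv w)).
have lac : linear antipode_conv by exact: klift_linear antipode_conv_pre.
have Kb : bilinear_map (fun (m : N) (w : (H ⊗ (H ⊗ H))%type) =>
    klift (fun (a b : H) => (m ⊗ a) ⊗ b) (antipode_conv w)).
  exact: (bilinear_comp2 (g := idfun) kb).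
have lK : linear K by exact: klift_linear.
have lt : linear (tmap (@idfun N) (tmap (@idfun H) (@hdelta k H))).
  exact (linear_tmap (@linear_idfun k N) (linear_tmap (@linear_idfun k H) ld)).
have -> x : untwist rho x =
    K (tmap idfun (tmap idfun hdelta) (tassoc (tmap rho idfun x))).
  move: x; apply: tensk_ext.
  - exact: untwist_linear.
  - apply: (linear_comp (f := K)) => //.
    apply: (linear_comp (f := tmap idfun (tmap idfun hdelta))) => //.
    apply: (linear_comp (f := @tassoc k N H H)); first exact: linear_tassoc.
    exact: linear_tmap.
  move=> m h; rewrite untwistE // tmapE //.
  have ub1 x := (mulHr_bilinear N).2 x.
  have ub (x : N ⊗ H) : bilinear_map (fun h1 h2 : H => mulHr x (hantipode h1)
    ⊗ h2).
    split=> [v|u] a y z /=; last by rewrite linear_purer.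
    by rewrite hantipode_linear ub1 linear_purel.
  move: (rho m); apply: tensk_ext.
  - move=> a x y; rewrite -klift_scaleadd; apply: eq_klift => h1 h2.
    by rewrite (mulHr_bilinear _).1 linear_purel.
  - apply: (linear_comp (f := K)) => //.
    apply: (linear_comp (f := tmap idfun (tmap idfun hdelta))) => //.
    apply: (linear_comp (f := @tassoc k N H H)); first exact: linear_tassoc.
    exact: linear_purel.
  move=> m' g; rewrite tassocE tmapE //; last exact: linear_tmap.
  rewrite /K (kliftE Kb) tmapE // antipode_convE; move: (hdelta h);
    apply: tensk_ext.
  - exact: klift_linear.
  - apply: (linear_comp (f := klift (fun a b : H => (m' ⊗ a) ⊗ b))).
      exact: klift_linear.
    exact/klift_linear/antipode_conv_pre1.
  move=> a b; rewrite (kliftE (ub _)) mulHrE.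
  by rewrite (kliftE (antipode_conv_pre1 _)) (kliftE (kb1 _)).
rewrite coas; move: (rho n); apply: tensk_ext.
- apply: (linear_comp (f := K)) => //.
  apply: (linear_comp (f := tmap idfun (tmap idfun hdelta))) => //.
  exact: linear_tmap.
- exact: insert1_linear.
move=> m h; rewrite insert1E !tmapE //; last exact: linear_tmap.
by rewrite /K (kliftE Kb) antipode_conv_delta (kliftE (kb1 _)).
Qed.

(** Transports the identity of [untwist_coact] along a comodule map, in
    particular p |-> p ⊗ 1 from P to P ⊗ P. *)
Lemma untwist_natural (N N' : lmodType k) (rho : N -> N ⊗ H)
    (rho' : N' -> N' ⊗ H) (f : N -> N') : linear rho -> linear rho' ->
      linear f ->
  (forall n, rho' (f n) = tmap f idfun (rho n)) ->
  forall x, untwist rho' (tmap f idfun x) =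
    tmap (tmap f idfun) idfun (untwist rho x).
Proof.
move=> lr lr' lf E.
have lt := linear_tmap lf (@linear_idfun k H).
have ltt := linear_tmap lt (@linear_idfun k H).
have lu := untwist_linear lr; have lu' := untwist_linear lr'.
apply: tensk_ext.
- exact: (linear_comp (f := untwist rho')).
- exact: (linear_comp (g := untwist rho)).
move=> n h; rewrite tmapE // !untwistE // E.
have b1 := untwist_pre1 rho n.
have b2 := bilinear_post b1 ltt.
have b3 : bilinear_map (fun h1 h2 : H => mulHr (tmap f idfun (rho n))
  (hantipode h1) ⊗ h2).
  by have := untwist_pre1 rho' (f n); rewrite E.
move: (hdelta h); apply: tensk_ext.
- exact: klift_linear.
- by apply: (linear_comp (g := klift _)) => //; exact: klift_linear.
move=> h1 h2; rewrite (kliftE b3) (kliftE b1) [RHS]tmapE //.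
by rewrite tmap_mulHr.
Qed.

Lemma insert1_natural (N N' : lmodType k) (f : N -> N') : linear f ->
  forall x : N ⊗ H, insert1 (tmap f idfun x) =
    tmap (tmap f idfun) idfun (insert1 x).
Proof.
move=> lf; have lt := linear_tmap lf (@linear_idfun k H).
have ltt := linear_tmap lt (@linear_idfun k H).
apply: tensk_ext.
- by apply: (linear_comp (f := @insert1 N')) => //; exact: insert1_linear.
- by apply: (linear_comp (g := @insert1 N)) => //; exact: insert1_linear.
by move=> n h; rewrite tmapE // !insert1E !tmapE.
Qed.

End Untwist.

(** * Relative Hopf modules *)

Section HopfModule.
Variables (k : fieldType) (H : hopfAlgType k) (P : comodAlgType H).
Local Notation B := (coinv P).

Section FirstFactor.
Variables (M : lmodType k) (act : M -> P -> M).
Hypothesis Mact : algebra_action act.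
Let actB := aact_bilinear Mact.

(** P acts on M ⊗ H through M only; with this action M ⊗ H is the target of m
    |-> m_0 ⊗ m_1 - m ⊗ 1 in the category of right B-modules. *)
Definition act_fst (x : M ⊗ H) (y : P) : M ⊗ H := hmul act x (y ⊗ (1 : H)).

Lemma act_fst_action : algebra_action act_fst.
Proof.
have hb := hmul_bilinear H actB.
split=> [|x y z|x].
- exact: (bilinear_comp2 (g := idfun)) hb _ (@linear_purel k P H 1).
- rewrite /act_fst; have -> : (y * z) ⊗ (1 : H) =
      hmul (fun x y : P => x * y) (y ⊗ (1 : H)) (z ⊗ (1 : H)).
    by rewrite hmulE ?mulr1 //; exact: bilinear_mul.
  rewrite -(hmulA (b1 := act) (b2 := act)) //; first exact: bilinear_mul.
  by move=> m n q; rewrite (aactM Mact).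
- move: x; apply: tensk_ext => //; first exact: hb.1.
  by move=> m h; rewrite /act_fst hmulE // (aact1 Mact) mulr1.
Qed.

Lemma insert1_hmul (m : M) (w : P ⊗ H) :
  insert1 (hmul act (m ⊗ (1 : H)) w) = hmul act_fst ((m ⊗ (1 : H)) ⊗ (1 : H)) w.
Proof.
have hb := hmul_bilinear H actB.
have hb' := hmul_bilinear H (aact_bilinear act_fst_action).
move: w; apply: tensk_ext.
- apply: (linear_comp (f := @insert1 k H M));
    [exact: insert1_linear|exact: hb.2].
- exact: hb'.2.
move=> x h; rewrite !hmulE //; last exact: aact_bilinear act_fst_action.
by rewrite insert1E /act_fst hmulE // mulr1.
Qed.
End FirstFactor.

Variables (M : lmodType k) (act : M -> P -> M) (rho : M -> M ⊗ H).
Hypotheses (Mact : algebra_action act) (lrho : linear rho).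
Hypothesis rhoM : forall m y, rho (act m y) = hmul act (rho m) (coact y).
Variables (M0 : zmodType) (r0 : M0 -> B -> M0) (iota : M0 -> M).
Hypotheses (M0act : right_action r0) (iotaD : {morph iota : x y / x + y}).
Hypotheses (iota_inj : injective iota).
Hypothesis iota_r0 : forall m b, iota (r0 m b) = act (iota m) (b : P).
Hypothesis iota_coinv : forall m, rho m =
  m ⊗ (1 : H) <-> exists m0, iota m0 = m.
Hypotheses (galP : hopf_galois P) (ffP : faithfully_flat (@coinv_act k H P)).
Let actB := aact_bilinear Mact.
Let MHact := act_fst_action Mact.

(** The submodule of coinvariants of M is given as M0 with an injection iota,
    since in the applications it is a type of its own: B, the algebra L, or a
    subtype. *)
Definition coinv_mul : tens r0 (@coinv_act k H P) -> M :=
  tlift (fun m y => act (iota m) y).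

Lemma coinv_mul_balanced : balanced r0 (@coinv_act k H P)
  (fun m y => act (iota m) y).
Proof.
split=> *.
- by rewrite iotaD (linear_add (actB.1 _)).
- by rewrite (linear_add (actB.2 _)).
- by rewrite iota_r0 -(aactM Mact).
Qed.

Lemma coinv_mulE m y : coinv_mul (pure _ _ m y) = act (iota m) y.
Proof. exact: tliftE coinv_mul_balanced _ _. Qed.

Lemma coinv_mulD : {morph coinv_mul : x y / x + y}.
Proof. exact: tliftD coinv_mul_balanced. Qed.

Definition tens_mulr (y : P) :
    tens r0 (@coinv_act k H P) -> tens r0 (@coinv_act k H P) :=
  tlift (fun m x => pure _ _ m (x * y)).

Lemma coinv_mul_mulr y w : coinv_mul (tens_mulr y w) = act (coinv_mul w) y.
Proof.
have bal : balanced r0 (@coinv_act k H P)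
    (fun m x => pure r0 (@coinv_act k H P) m (x * y)).
  split=> *; first exact: pureDl.
    by rewrite mulrDl pureDr.
  by rewrite pure_bal /coinv_act mulrA.
move: w; apply: tens_ext => [u v|u v|m x].
- by rewrite [tens_mulr _ _](tliftD bal) coinv_mulD.
- by rewrite coinv_mulD (linear_add (actB.1 _)).
- by rewrite [tens_mulr _ _](tliftE bal) !coinv_mulE (aactM Mact).
Qed.

(** For m coinvariant, m y_0 ⊗ y_1 = (m y)_0 ⊗ (m y)_1. *)
Lemma module_galois_coinv_mul w :
  module_galois act (tensmap (coinv_res act) iota w) = rho (coinv_mul w).
Proof.
move: w; apply: tens_ext => [x y|x y|m y].
- by rewrite tensmapD // module_galoisD.
- by rewrite coinv_mulD (linear_add lrho).
- rewrite tensmapE // module_galoisE // coinv_mulE rhoM.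
  by congr hmul; symmetry; apply/iota_coinv; exists m.
Qed.

(** The coaction of the product is a composite of two injections, by flatness
    and by the Galois property. *)
Lemma coinv_mul_inj : injective coinv_mul.
Proof.
move=> x y e.
apply: (flat_injective ffP M0act (coinv_res_action Mact)
  iotaD iota_r0 iota_inj).
by apply: (module_galois_inj galP Mact); rewrite !module_galois_coinv_mul e.
Qed.

Let coinv_def (m : M) : M ⊗ H := rho m - m ⊗ (1 : H).

Let coinv_def_linear : linear coinv_def.
Proof. by apply: linear_subfun => //; exact: linear_purel. Qed.

Let coinv_def_res m (b : B) :
  coinv_def (coinv_res act m b) = coinv_res (act_fst act) (coinv_def m) b.
Proof.
rewrite /coinv_res /coinv_def rhoM coact_coinv.
have l := (aact_bilinear MHact).1 (b : P).
rewrite (linear_add l) (linear_opp l); congr (_ - _).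
by rewrite /act_fst hmulE // mulr1.
Qed.

Lemma untwist_hmul m (w : P ⊗ H) :
  untwist rho (hmul act (m ⊗ (1 : H)) w) =
  tmap (hmul act (rho m)) idfun (untwist (@coact k H P) w).
Proof.
have hb := hmul_bilinear H actB.
have [cl _ _] := @coact_alg_map k H P.
have lt : linear (tmap (hmul act (rho m)) (@idfun H)).
  by apply: linear_tmap => //; exact: hb.2.
move: w; apply: tensk_ext.
- apply: (linear_comp (f := untwist rho));
    [exact: untwist_linear | exact: hb.2].
- apply: (linear_comp (g := untwist (@coact k H P))) => //;
    exact: untwist_linear.
move=> x h; rewrite hmulE // mul1r !untwistE //.
have b1 := untwist_pre1 (@coact k H P) x.
have b2 := untwist_pre1 rho (act m x).
move: (hdelta h); apply: tensk_ext.
- exact: klift_linear.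
- by apply: (linear_comp (g := klift _)) => //; exact: klift_linear.
move=> h1 h2; rewrite (kliftE b1) (kliftE b2) tmapE //; last exact: hb.2.
by rewrite rhoM mulHr_hmul.
Qed.

(** (m y_0)_0 ⊗ (m y_0)_1 S(y_1) ⊗ y_2 = m_0 y_0 ⊗ m_1 ⊗ y_1. *)
Lemma untwist_module_galois m y :
  untwist rho (hmul act (m ⊗ (1 : H)) (coact y)) =
  hmul (act_fst act) (rho m ⊗ (1 : H)) (coact y).
Proof.
have hb := hmul_bilinear H actB.
have hb' := hmul_bilinear H (aact_bilinear MHact).
have [cl _ _] := @coact_alg_map k H P.
rewrite untwist_hmul untwist_coact //; last exact: coact_coassoc.
move: (coact y); apply: tensk_ext.
- apply: (linear_comp (g := @insert1 k H P)); last exact: insert1_linear.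
  by apply: linear_tmap => //; exact: hb.2.
- exact: hb'.2.
move=> x h; rewrite insert1E tmapE //; last exact: hb.2.
by rewrite hmulE ?mul1r //; exact: aact_bilinear MHact.
Qed.

(** Let w in M ⊗_B P have image m_0 ⊗ m_1 in M ⊗ H. The map m |-> m_0 ⊗ m_1 -
    m ⊗ 1, tensored with P, kills w: in (M ⊗ H) ⊗ H its value is the
    difference of the two sides of the hypothesis on m. By flatness w comes
    from the coinvariants. *)
Lemma coinv_mul_preimage m : injective rho ->
  untwist rho (rho m) = insert1 (rho m) ->
  exists w, coinv_mul w = m.
Proof.
move=> rinj star.
have hb' := hmul_bilinear H (aact_bilinear MHact).
have kK := module_galois_invK galP Mact.
have dD := linear_add coinv_def_linear.
have E : exact_at iota coinv_def.
  move=> x; rewrite -iota_coinv /coinv_def.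
  by split=> [/eqP|->]; rewrite ?subrr // subr_eq0 => /eqP.
have := (faithfully_flat_exact ffP M0act (coinv_res_action Mact)
  (coinv_res_action MHact) iotaD iota_r0 dD coinv_def_res).1 E.
move=> /(_ (module_galois_inv act (rho m)))[+ _] => /(_ _)[|w wE]; last first.
  exists w; apply: rinj; rewrite -module_galois_coinv_mul wE; exact: kK.
have tD := tensmapD dD coinv_def_res.
apply: (module_galois_inj galP MHact); rewrite (morph0 (module_galoisD MHact)).
have -> z : module_galois (act_fst act) (tensmap (coinv_res (act_fst act))
  coinv_def z) =
    untwist rho (module_galois act z) - insert1 (module_galois act z).
  move: z; apply: tens_ext => [x y|x y|x y].
  - by rewrite tD module_galoisD.
  - rewrite module_galoisD // (linear_add (untwist_linear lrho)).
    by rewrite (linear_add (@insert1_linear k H M)) opprD addrACA.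
  - rewrite tensmapE // !module_galoisE // untwist_module_galois insert1_hmul
      //.
    rewrite /coinv_def (linear_add (@linear_purel k (M ⊗ H)%type H 1)).
    rewrite (linear_opp (@linear_purel k (M ⊗ H)%type H 1)).
    by rewrite (linear_add (hb'.1 _)) (linear_opp (hb'.1 _)).
by rewrite kK star subrr.
Qed.

End HopfModule.
Arguments coinv_mul {k H P M} act {M0} r0 iota _.
Arguments tens_mulr {k H P M0 r0} y _.

(** * The Hopf module P ⊗ P and its coinvariants *)

Section ESHopfModule.
Variables (k : fieldType) (H : hopfAlgType k) (P : comodAlgType H).
Local Notation B := (coinv P).

(** (p ⊗ x) y = p ⊗ xy. *)
Definition PPact (X : PPop P) (y : P) : PPop P := PPpure 1 y * X.

Lemma PPactE p x y : PPact (PPpure p x) y = PPpure p (x * y).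
Proof. by rewrite /PPact PPpureM mul1r. Qed.

Lemma PPact_action : algebra_action PPact.
Proof.
have [bl br] := PPpure_bilinear P.
split=> [|X x y|X].
- split=> [v|u] a x y /=; rewrite /PPact; first by rewrite mulrDr -scalerAr.
  by rewrite br mulrDl -scalerAl.
- by rewrite /PPact mulrA PPpureM mulr1.
- by rewrite /PPact mul1r.
Qed.

Lemma PPop_ext (W : zmodType) (f g : PPop P -> W) :
  {morph f : x y / x + y} -> {morph g : x y / x + y} ->
  (forall p q, f (PPpure p q) = g (PPpure p q)) -> f =1 g.
Proof. exact: tens_ext. Qed.

Lemma diag_coact_pure p q :
  diag_coact (PPpure p q) = hmul (@PPpure k H P) (coact p) (coact q).
Proof. exact: diag_coactE. Qed.

Lemma diag_coactD : {morph @diag_coact k H P : x y / x + y}.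
Proof. exact: linear_add (@diag_coact_linear k H P). Qed.

Lemma diag_coact_act X y :
  diag_coact (PPact X y) = hmul PPact (diag_coact X) (coact y).
Proof.
have actB := aact_bilinear PPact_action; have hb := hmul_bilinear H actB.
have pb := PPpure_bilinear P; have [_ cm _] := @coact_alg_map k H P.
move: X; apply: PPop_ext => [u v|u v|p x].
- by rewrite (linear_add (actB.1 _)) diag_coactD.
- by rewrite diag_coactD (linear_add (hb.1 _)).
rewrite PPactE !diag_coact_pure cm.
rewrite (hmulA (b3 := fun x y : P => x * y) (b4 := @PPpure k H P)) //.
  exact: bilinear_mul.
by move=> *; exact: PPactE.
Qed.

Lemma diag_coact_left p :
  diag_coact (PPpure p 1) = tmap (fun p => PPpure p (1 : P)) idfun (coact p).
Proof.
have [bl br] := PPpure_bilinear P;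
  have hb := hmul_bilinear H (PPpure_bilinear P).
have [_ _ c1] := @coact_alg_map k H P.
rewrite diag_coact_pure c1; move: (coact p); apply: tensk_ext.
- exact: hb.1.
- exact: linear_tmap.
move=> x h; rewrite hmulE ?mulr1 ?tmapE //; exact: PPpure_bilinear.
Qed.

(** The counit of H gives a retraction. *)
Lemma diag_coact_inj : injective (@diag_coact k H P).
Proof.
have [le em _] := @hcounit_alg_map k H; have [cl _ _] := @coact_alg_map k H P.
have cb (N : lmodType k) : bilinear_map (fun (n : N) (h : H)
  => (hcounit h : k) *: n).
  split=> [v|u] a x y /=; first by rewrite scalerDr !scalerA mulrC.
  by rewrite le scalerDl scalerA.
pose eps (N : lmodType k) := klift (fun (n : N) (h : H) => (hcounit h : k)
  *: n).
have le' N : linear (eps N) by exact: klift_linear.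
have hb := hmul_bilinear H (PPpure_bilinear P).
suff E : cancel (@diag_coact k H P) (eps (PPop P)) by exact: can_inj E.
move=> X; move: X; apply: PPop_ext => [u v|//|p q].
  by rewrite diag_coactD (linear_add (le' _)).
rewrite diag_coact_pure -[RHS]/(PPpure (id p) (id q)).
rewrite -{2}[p]coact_counit -{2}[q]coact_counit -!/(eps P _).
move: (coact p) (coact q); apply: tensk_ext2.
- by apply: (bilinear_post (f := hmul (@PPpure k H P))) => //; exact: le'.
- by apply: (bilinear_comp2 (f := @PPpure k H P));
    [exact: PPpure_bilinear | exact: le' | exact: le'].
move=> x h y g; rewrite hmulE ?/eps; last exact: PPpure_bilinear.
rewrite !(kliftE (cb _)) em.
rewrite (linear_scale ((PPpure_bilinear P).1 _))
  (linear_scale ((PPpure_bilinear P).2 _)).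
by rewrite scalerA.
Qed.

(** The right B-module structure of L used in L ⊗_B L. *)
Definition ES_right (X : ES P) (c : B) : ES P := ES_target c * X.

Lemma ES_valM (X Y : ES P) : ES_val (X * Y) = ES_val X * ES_val Y.
Proof. exact: rmorphM (val : ES P -> PPop P) X Y. Qed.

Lemma ES_valD : {morph @ES_val k H P : X Y / X + Y}.
Proof. exact: raddfD (val : ES P -> PPop P). Qed.

Lemma ES_val_inj : injective (@ES_val k H P).
Proof. exact: val_inj. Qed.

Lemma PPop_targetD (b c : B) : PPop_target (b + c) =
  PPop_target b + PPop_target c.
Proof. exact: purekDr. Qed.

Lemma ES_targetD (b c : B) : ES_target (b + c) = ES_target b + ES_target c.
Proof. by apply: ES_val_inj; rewrite ES_valD; exact: PPop_targetD. Qed.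

Lemma ES_targetM (b c : B) : ES_target (b * c) = ES_target c * ES_target b.
Proof. by apply: ES_val_inj; rewrite ES_valM /= /PPop_target PPpureM mulr1. Qed.

Lemma ES_target1 : ES_target (1 : B) = 1.
Proof. exact: ES_val_inj. Qed.

Lemma ES_right_action : right_action ES_right.
Proof.
split=> *; rewrite /ES_right.
- by rewrite mulrDr.
- by rewrite ES_targetD mulrDl.
- by rewrite ES_targetM mulrA.
- by rewrite ES_target1 mul1r.
Qed.

Lemma ES_val_right X c : ES_val (ES_right X c) = PPact (ES_val X) (c : P).
Proof. exact: ES_valM. Qed.

Lemma ES_coinv (X : PPop P) : diag_coact X =
  X ⊗ (1 : H) <-> exists Y : ES P, ES_val Y = X.
Proof.
split=> [e|[[Y /= /asboolP e] <-] //].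
by have XE : X \in @ES_pred k H P by [exact/asboolP]; exists (MkES XE).
Qed.

Hypotheses (galP : hopf_galois P) (ffP : faithfully_flat (@coinv_act k H P)).

Local Notation mu := (coinv_mul PPact ES_right (@ES_val k H P)).

Lemma ES_muE X y : mu (pure _ _ X y) = PPact (ES_val X) y.
Proof. exact: (coinv_mulE PPact_action ES_valD ES_val_right). Qed.

Lemma ES_muD : {morph mu : x y / x + y}.
Proof. exact: (coinv_mulD PPact_action ES_valD ES_val_right). Qed.

Lemma ES_mu_inj : injective mu.
Proof.
exact: (coinv_mul_inj PPact_action (@diag_coact_linear k H P) diag_coact_act
  ES_right_action ES_valD ES_val_inj ES_val_right ES_coinv galP ffP).
Qed.

(** The elements p ⊗ 1 form a copy of the comodule P inside P ⊗ P, where the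
    cancellation of the antipode is available. *)
Lemma ES_mu_left p : exists w, mu w = PPpure p 1.
Proof.
apply: (coinv_mul_preimage PPact_action (@diag_coact_linear k H P)
  diag_coact_act
  ES_right_action ES_valD ES_val_right ES_coinv galP ffP).
  exact: diag_coact_inj.
have [cl _ _] := @coact_alg_map k H P; have [bl _] := PPpure_bilinear P.
rewrite diag_coact_left (untwist_natural (rho := @coact k H P)) //; first last.
- exact: diag_coact_left.
- exact: diag_coact_linear.
by rewrite untwist_coact ?insert1_natural //; exact: coact_coassoc.
Qed.

(** P ⊗ P is generated by the elements p ⊗ 1 as a right P-module. *)
Lemma ES_mu_surj X : exists w, mu w = X.
Proof.
move: X; apply: (tens_ind (Q := fun X => exists w, mu w = X)).
- by exists 0; rewrite (morph0 ES_muD).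
- by move=> u v [u' <-] [v' <-]; exists (u' + v'); rewrite ES_muD.
- move=> p q; have [w wE] := ES_mu_left p; exists (tens_mulr q w).
  rewrite (coinv_mul_mulr PPact_action ES_valD ES_val_right) wE.
  by rewrite PPactE mul1r.
Qed.

(** The form in which L ⊗_B P = P ⊗ P is used below: an identity between
    additive maps on P ⊗ P may be checked on the products of an element of L
    by an element of P. *)
Lemma PPop_coinv_span (W : zmodType) (f g : PPop P -> W) :
  {morph f : x y / x + y} -> {morph g : x y / x + y} ->
  (forall (X : ES P) y, f (PPact (ES_val X) y) = g (PPact (ES_val X) y)) ->
    f =1 g.
Proof.
move=> fD gD e X; have [w <-] := ES_mu_surj X.
move: w; apply: tens_ext => [u v|u v|Y y]; rewrite ?ES_muD ?fD ?gD //.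
by rewrite ES_muE.
Qed.

End ESHopfModule.

(** * From automorphisms to bisections *)

Section Bisections.
Variables (k : fieldType) (H : hopfAlgType k) (P : comodAlgType H).
Local Notation B := (coinv P).
Local Notation Aut := (@comod_alg_aut k H P).
Implicit Types F G : P -> P.

Lemma coinv_valM (b c : B) : (b * c : B) = (b : P) * (c : P) :> P.
Proof. exact: rmorphM (val : B -> P) b c. Qed.

Lemma coinv_valD : {morph @coinv_val k H P : b c / b + c}.
Proof. exact: raddfD (val : B -> P). Qed.

Lemma coinv_val_linear : linear (@coinv_val k H P).
Proof. exact: linearP (val : B -> P). Qed.

Lemma coinv_val_inj : injective (@coinv_val k H P).
Proof. exact: val_inj. Qed.

Lemma coactM (p q : P) : coact (p * q) =
  hmul (fun x y : P => x * y) (coact p) (coact q).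
Proof. by have [_ -> _] := @coact_alg_map k H P. Qed.

Lemma aut_inv F G : Aut F -> cancel F G -> cancel G F -> Aut G.
Proof.
move=> [[[lF FM F1] _] Fc] FK GK.
have lG : linear G.
  by move=> a x y; apply: (can_inj FK); rewrite lF !GK.
have ltF := linear_tmap lF (@linear_idfun k H).
have ltG := linear_tmap lG (@linear_idfun k H).
split.
  split; last by exists F.
  split=> // [x y|]; last by rewrite -F1 FK.
  by apply: (can_inj FK); rewrite FM !GK.
move=> p; rewrite -{2}[p]GK Fc; move: (coact (G p)); apply: tensk_ext => //.
  by apply: (linear_comp (f := tmap G idfun) (g := tmap F idfun)).
by move=> x h; rewrite tmapE // tmapE // FK.
Qed.

Lemma aut_comp F G : Aut F -> Aut G -> Aut (F \o G).
Proof.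
move=> [[[lF FM F1] bF] Fc] [[[lG GM G1] bG] Gc].
split.
  split; last exact: bij_comp.
  split=> [a x y|x y|] /=; first by rewrite lG lF.
    by rewrite GM FM.
  by rewrite G1 F1.
move=> p /=; rewrite Fc Gc; move: (coact p); apply: tensk_ext.
- apply: (linear_comp (f := tmap F idfun) (g := tmap G idfun));
    exact: linear_tmap.
- by apply: linear_tmap => // a x y /=; rewrite lG lF.
move=> x h; rewrite !tmapE //.
by move=> a x' y /=; rewrite lG lF.
Qed.

Lemma aut_group : is_group Aut (fun F G : P -> P => F \o G) idfun.
Proof.
split=> //.
- exact: aut_comp.
- split=> [|p]; first by split=> //; exists idfun.
  rewrite -[LHS]/(idfun (coact p)); move: (coact p); apply: tensk_ext => //.
    exact: linear_tmap.
  by move=> x h; rewrite tmapE.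
- move=> F AF; have [[_ [G FK GK]] _] := AF.
  exists G; split; first exact: aut_inv AF FK GK.
    by apply/funext => x; exact: GK.
  by apply/funext => x; exact: FK.
Qed.

Section Hat.
Variable beta : P -> P -> P.
Hypothesis bb : bilinear_map beta.

Definition PPlift : PPop P -> P := klift (fun (p : P) (q : P^c)
  => beta p (q : P)).

Lemma PPlift_linear : linear PPlift.
Proof. exact: (@klift_linear k P P^c P beta bb). Qed.

Lemma PPliftD : {morph PPlift : x y / x + y}.
Proof. exact: linear_add PPlift_linear. Qed.

Lemma PPliftE p q : PPlift (PPpure p q) = beta p q.
Proof. exact: (@kliftE k P P^c P beta bb). Qed.

Hypothesis beta_coact : forall p q, coact (beta p q) =
  hmul beta (coact p) (coact q).

Lemma coact_PPlift X : coact (PPlift X) = tmap PPlift idfun (diag_coact X).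
Proof.
have [lc _ _] := @coact_alg_map k H P.
have lt := linear_tmap PPlift_linear (@linear_idfun k H).
move: X; apply: PPop_ext => [X Y|X Y|p q].
- by rewrite PPliftD (linear_add lc).
- by rewrite diag_coactD (linear_add lt).
rewrite PPliftE beta_coact diag_coact_pure tmap_hmul.
- by apply: eq_hmul => p' q'; rewrite PPliftE.
- exact: PPpure_bilinear.
- exact: PPlift_linear.
Qed.

Lemma PPlift_coinv (X : ES P) : PPlift (ES_val X) \in @coinv_pred k H P.
Proof.
apply/asboolP; rewrite coact_PPlift.
have -> := (ES_coinv (ES_val X)).2 (ex_intro _ X erefl).
by rewrite tmapE //; exact: PPlift_linear.
Qed.

End Hat.

Definition left_pairing F := PPlift (fun p q => F p * q).
Definition right_pairing F := PPlift (fun p q => p * F q).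

(** The default value 0 is never taken when F is a comodule algebra
    automorphism ([left_bis_of_autE]). *)
Definition left_bis_of_aut F (X : ES P) : B := insubd (0 : B)
  (left_pairing F (ES_val X)).
Definition right_bis_of_aut F (X : ES P) : B := insubd (0 : B)
  (right_pairing F (ES_val X)).

Section OneAut.
Variable F : P -> P.
Hypothesis AF : Aut F.
Let lF : linear F. Proof. by case: AF => [[[]]]. Qed.
Let FM : {morph F : x y / x * y}. Proof. by case: AF => [[[]]]. Qed.
Let F1 : F 1 = 1. Proof. by case: AF => [[[]]]. Qed.

Lemma left_pairing_bilinear : bilinear_map (fun p q => F p * q).
Proof. exact: (bilinear_comp2 (h := idfun) (@bilinear_mul k P)). Qed.

Lemma right_pairing_bilinear : bilinear_map (fun p q => p * F q).
Proof. exact: (bilinear_comp2 (g := idfun) (@bilinear_mul k P)). Qed.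

Lemma left_pairingE p q : left_pairing F (PPpure p q) = F p * q.
Proof. exact: PPliftE left_pairing_bilinear _ _. Qed.

Lemma right_pairingE p q : right_pairing F (PPpure p q) = p * F q.
Proof. exact: PPliftE right_pairing_bilinear _ _. Qed.

Lemma left_pairingD : {morph left_pairing F : x y / x + y}.
Proof. exact: PPliftD left_pairing_bilinear. Qed.

Lemma right_pairingD : {morph right_pairing F : x y / x + y}.
Proof. exact: PPliftD right_pairing_bilinear. Qed.

Lemma left_bis_of_autE X : left_bis_of_aut F X = left_pairing F (ES_val X) :> P.
Proof.
rewrite [LHS](@insubdK _ _ (B : subType _)) //; apply: PPlift_coinv.
  exact: left_pairing_bilinear.
move=> p q; have [_ Fc] := AF.
by rewrite coactM Fc hmul_tmapl //; exact: bilinear_mul.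
Qed.

Lemma right_bis_of_autE X : right_bis_of_aut F X =
  right_pairing F (ES_val X) :> P.
Proof.
rewrite [LHS](@insubdK _ _ (B : subType _)) //; apply: PPlift_coinv.
  exact: right_pairing_bilinear.
move=> p q; have [_ Fc] := AF.
by rewrite coactM Fc hmul_tmapr //; exact: bilinear_mul.
Qed.

Lemma left_pairing_mul p q Y : left_pairing F (PPpure p q * Y) =
  F p * left_pairing F Y * q.
Proof.
move: Y; apply: PPop_ext => [x y|x y|r u].
- by rewrite mulrDr left_pairingD.
- by rewrite left_pairingD mulrDr mulrDl.
- by rewrite PPpureM !left_pairingE FM !mulrA.
Qed.

Lemma right_pairing_mul p q Y : right_pairing F (PPpure p q * Y) =
  p * right_pairing F Y * F q.
Proof.
move: Y; apply: PPop_ext => [x y|x y|r u].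
- by rewrite mulrDr right_pairingD.
- by rewrite right_pairingD mulrDr mulrDl.
- by rewrite PPpureM !right_pairingE FM !mulrA.
Qed.

Lemma left_pairing_act X y : left_pairing F (PPact X y) = left_pairing F X * y.
Proof. by rewrite left_pairing_mul F1 mul1r. Qed.

Lemma left_bis_of_aut_source b : left_bis_of_aut F (ES_source b) = F b :> P.
Proof. by rewrite left_bis_of_autE /= left_pairingE mulr1. Qed.

Lemma right_bis_of_aut_target b : right_bis_of_aut F (ES_target b) = F b :> P.
Proof. by rewrite right_bis_of_autE /= right_pairingE mul1r. Qed.

End OneAut.

(** For F in Aut_H(P) with inverse G, the automorphism of B is the restriction
    of F, with inverse the restriction of G. *)
Lemma left_bis_of_autP F : Aut F ->
  left_bisection (@ES_source k H P) (@ES_target k H P) (left_bis_of_aut F).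
Proof.
move=> AF; have [[[lF FM F1] [G FK GK]] Fc] := AF.
have AG := aut_inv AF FK GK.
have sK (F' G' : P -> P) : Aut F' -> Aut G' -> cancel F' G' ->
    cancel (left_bis_of_aut F' \o @ES_source k H P)
      (left_bis_of_aut G' \o @ES_source k H P).
  by move=> A1 A2 K b; apply: coinv_val_inj;
    rewrite /= left_bis_of_aut_source // left_bis_of_aut_source.
have hl := PPlift_linear (left_pairing_bilinear AF).
split.
- move=> a X Y; apply: coinv_val_inj;
    rewrite coinv_val_linear !left_bis_of_autE //.
  by rewrite -hl -(linearP (val : ES P -> PPop P)).
- by apply: coinv_val_inj; rewrite left_bis_of_autE // left_pairingE // F1
    mulr1.
- move=> b X; apply: coinv_val_inj.
  by rewrite coinv_valM !left_bis_of_autE // ES_valM left_pairing_mul // F1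
    mul1r.
- split; last by exists (left_bis_of_aut G \o @ES_source k H P); exact: sK.
  split=> [a b c|b c|]; apply: coinv_val_inj.
  + by rewrite coinv_val_linear /= !left_bis_of_aut_source //
      coinv_val_linear lF.
  + by rewrite coinv_valM /= !left_bis_of_aut_source // coinv_valM FM.
  + by rewrite /= left_bis_of_aut_source.
- move=> X Y; apply: coinv_val_inj; rewrite !left_bis_of_autE // !ES_valM /=.
  rewrite /PPop_target left_bis_of_autE //; move: (ES_val X);
    apply: PPop_ext => [x y|x y|p q].
  + by rewrite mulrDl left_pairingD.
  + by rewrite mulrDl left_pairingD.
  + by rewrite !left_pairing_mul // left_pairingE // F1 mul1r.
- exists (left_bis_of_aut G \o @ES_source k H P); split; [exact: sK|exact: sK|].
  move=> X Y; apply: coinv_val_inj; rewrite !left_bis_of_autE // !ES_valM /=.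
  rewrite /PPop_source left_bis_of_aut_source // left_bis_of_autE //.
  move: (ES_val X); apply: PPop_ext => [x y|x y|p q].
  + by rewrite mulrDl left_pairingD.
  + by rewrite mulrDl left_pairingD.
  + by rewrite !left_pairing_mul // left_pairingE // GK mulr1.
Qed.

Lemma right_bis_of_autP F : Aut F ->
  right_bisection (@ES_source k H P) (@ES_target k H P) (right_bis_of_aut F).
Proof.
move=> AF; have [[[lF FM F1] [G FK GK]] Fc] := AF.
have AG := aut_inv AF FK GK.
have sK (F' G' : P -> P) : Aut F' -> Aut G' -> cancel F' G' ->
    cancel (right_bis_of_aut F' \o @ES_target k H P)
      (right_bis_of_aut G' \o @ES_target k H P).
  by move=> A1 A2 K b; apply: coinv_val_inj;
    rewrite /= right_bis_of_aut_target // right_bis_of_aut_target.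
have hl := PPlift_linear (right_pairing_bilinear AF).
split.
- move=> a X Y; apply: coinv_val_inj;
    rewrite coinv_val_linear !right_bis_of_autE //.
  by rewrite -hl -(linearP (val : ES P -> PPop P)).
- by apply: coinv_val_inj; rewrite right_bis_of_autE // right_pairingE // F1
    mulr1.
- move=> b X; apply: coinv_val_inj.
  by rewrite coinv_valM !right_bis_of_autE // ES_valM right_pairing_mul // F1
    mulr1.
- split; last by exists (right_bis_of_aut G \o @ES_target k H P); exact: sK.
  split=> [a b c|b c|]; apply: coinv_val_inj.
  + by rewrite coinv_val_linear /= !right_bis_of_aut_target //
      coinv_val_linear lF.
  + by rewrite coinv_valM /= !right_bis_of_aut_target // coinv_valM FM.
  + by rewrite /= right_bis_of_aut_target.
- move=> X Y; apply: coinv_val_inj; rewrite !right_bis_of_autE // !ES_valM /=.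
  rewrite /PPop_source right_bis_of_autE //; move: (ES_val X);
    apply: PPop_ext => [x y|x y|p q].
  + by rewrite mulrDl right_pairingD.
  + by rewrite mulrDl right_pairingD.
  + by rewrite !right_pairing_mul // right_pairingE // F1 mulr1.
- exists (right_bis_of_aut G \o @ES_target k H P); split;
    [exact: sK|exact: sK|].
  move=> X Y; apply: coinv_val_inj; rewrite !right_bis_of_autE // !ES_valM /=.
  rewrite /PPop_target right_bis_of_aut_target // right_bis_of_autE //.
  move: (ES_val X); apply: PPop_ext => [x y|x y|p q].
  + by rewrite mulrDl right_pairingD.
  + by rewrite mulrDl right_pairingD.
  + by rewrite !right_pairing_mul // right_pairingE // GK mul1r.
Qed.

End Bisections.

(** * From bisections to automorphisms *)

Section FromBisections.
Variables (k : fieldType) (H : hopfAlgType k) (P : comodAlgType H).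
Local Notation B := (coinv P).
Local Notation Aut := (@comod_alg_aut k H P).
Local Notation mulP := (fun x y : P => x * y).
Local Notation s := (@ES_source k H P).
Local Notation t := (@ES_target k H P).
Hypotheses (galP : hopf_galois P) (ffP : faithfully_flat (@coinv_act k H P)).

Lemma coact_inj : injective (@coact k H P).
Proof. exact: can_inj (@coact_counit k H P). Qed.

(** P is a relative Hopf module with P acting through F, and its coinvariants
    are B with B acting on the right through phi. Hence b ⊗ y |-> b F(y) is a
    bijection onto P. As b F(y) = F(phi^-1(b) y), the map F is onto, and F(p)
    = F(q) gives 1 ⊗ p = 1 ⊗ q, whence p = q by b ⊗ y |-> phi^-1(b) y. *)
Lemma comod_alg_map_bij (F : P -> P) : alg_map F ->
  (forall p, coact (F p) = tmap F idfun (coact p)) ->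
  (exists phi psi : B -> B, [/\ alg_map phi, forall b : B, F b = phi b,
     cancel phi psi & cancel psi phi]) ->
  bijective F.
Proof.
move=> [lF FM F1] Fc [phi [psi [[lphi phiM phi1] Fphi phiK psiK]]].
have [cl _ _] := @coact_alg_map k H P.
pose act (m y : P) := m * F y.
have Ma : algebra_action act.
  split=> [|m x y|m]; last by rewrite /act F1 mulr1.
    exact: (bilinear_comp2 (g := idfun) (@bilinear_mul k P)).
  by rewrite /act FM mulrA.
pose r0 (b c : B) := b * phi c.
have R0 : right_action r0.
  split=> *; rewrite /r0; first by rewrite mulrDl.
  - by rewrite (linear_add lphi) mulrDr.
  - by rewrite phiM mulrA.
  - by rewrite phi1 mulr1.
have cM m y : coact (act m y) = hmul act (coact m) (coact y).
  by rewrite /act coactM Fc hmul_tmapr //; exact: bilinear_mul.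
have ir (m b : B) : (r0 m b : P) = act m b.
  by rewrite /r0 coinv_valM /act Fphi.
have ic (m : P) : coact m = m ⊗ (1 : H) <-> exists m0 : B, (m0 : P) = m.
  split=> [e|[m0 <-]]; last exact: coact_coinv.
  by have mE : m \in @coinv_pred k H P by [exact/asboolP]; exists (Coinv mE).
have vD := @coinv_valD k H P; have vI := @coinv_val_inj k H P.
have minj := coinv_mul_inj Ma cl cM R0 vD vI ir ic galP ffP.
have msurj m := coinv_mul_preimage Ma cl cM R0 vD ir ic galP ffP (m := m)
  coact_inj
  (untwist_coact cl (@coact_coassoc k H P) m).
have psiD b c : psi (b + c) = psi b + psi c.
  by apply: (can_inj phiK); rewrite (linear_add lphi) !psiK.
have psiM b c : psi (b * c) = psi b * psi c.
  by apply: (can_inj phiK); rewrite phiM !psiK.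
have psi1 : psi 1 = 1 by rewrite -phi1 phiK.
pose xi := tlift (fun (b : B) (y : P) => (psi b : P) * y) :
  tens r0 (@coinv_act k H P) -> P.
have xb : balanced r0 (@coinv_act k H P) (fun (b : B) (y : P) => (psi b : P)
  * y).
  split=> *; first by rewrite psiD vD mulrDl.
    by rewrite mulrDr.
  by rewrite /r0 psiM phiK coinv_valM -mulrA.
have xiE w : F (xi w) = coinv_mul act r0 (@coinv_val k H P) w.
  move: w; apply: tens_ext => [x y|x y|b y].
  - by rewrite /xi (tliftD xb) (linear_add lF).
  - by rewrite (coinv_mulD Ma vD ir).
  - by rewrite /xi (tliftE xb) (coinv_mulE Ma vD ir) FM Fphi psiK.
have Finj : injective F.
  move=> p q e.
  have : pure r0 (@coinv_act k H P) 1 p = pure _ _ 1 q.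
    by apply: minj; rewrite !(coinv_mulE Ma vD ir) /act e.
  by move/(congr1 xi); rewrite /xi !(tliftE xb) psi1 !mul1r.
have Fsurj m : exists p, F p = m.
  by have [w <-] := msurj m; exists (xi w); rewrite xiE.
exists (fun m => projT1 (cid (Fsurj m))) => m; last by case: cid.
by apply: Finj; case: cid.
Qed.

(** The extension X y |-> sigma(X) y of sigma to P ⊗ P = L ⊗_B P. *)
Definition bis_ev (sigma : ES P -> B) (Z : PPop P) : P :=
  coinv_mul mulP (@ES_right k H P) (fun X => sigma X : P)
    (xget 0 [set w | coinv_mul (@PPact k H P) (@ES_right k H P)
      (@ES_val k H P) w = Z]).

(** p_0 ⊗ p_1^<1> ⊗ p_1^<2> is the element of L ⊗_B P corresponding to p ⊗ 1,
    so this is F(p) = sigma(p_0 ⊗ p_1^<1>) p_1^<2>. *)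
Definition bis_aut (sigma : ES P -> B) (p : P) : P := bis_ev sigma (PPpure p 1).

Section OneBisection.
Variable sigma : ES P -> B.
Hypothesis sb : left_bisection s t sigma.

Let sD : {morph sigma : X Y / X + Y}.
Proof. exact: linear_add (lbis_linear sb). Qed.
Let svD : {morph (fun X => sigma X : P) : X Y / X + Y}.
Proof. by move=> X Y; rewrite sD coinv_valD. Qed.
Let svr X (b : B) : (sigma (ES_right X b) : P) = (sigma X : P) * (b : P).
Proof. by rewrite /ES_right (lbis_target sb) coinv_valM. Qed.
Let mP := mul_action P.

Lemma bis_evE w : bis_ev sigma (coinv_mul (@PPact k H P) (@ES_right k H P)
  (@ES_val k H P) w) =
  coinv_mul mulP (@ES_right k H P) (fun X => sigma X : P) w.
Proof.
rewrite /bis_ev; congr coinv_mul; apply: (ES_mu_inj galP ffP).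
exact: (@xgetPex _ 0 [set w' | coinv_mul _ _ _ w' = _] (ex_intro _ w erefl)).
Qed.

Lemma bis_evD : {morph bis_ev sigma : x y / x + y}.
Proof.
move=> x y; have [u <-] := ES_mu_surj galP ffP x.
have [v <-] := ES_mu_surj galP ffP y.
by rewrite -ES_muD !bis_evE (coinv_mulD mP svD svr).
Qed.

Lemma bis_ev_coinv (X : ES P) y : bis_ev sigma (PPact (ES_val X) y) =
  (sigma X : P) * y.
Proof. by rewrite -ES_muE bis_evE (coinv_mulE mP svD svr). Qed.

Lemma PPactD y : {morph (fun X => @PPact k H P X y) : u v / u + v}.
Proof. exact: linear_add ((aact_bilinear (PPact_action P)).1 y). Qed.

Lemma bis_ev_act Z y : bis_ev sigma (PPact Z y) = bis_ev sigma Z * y.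
Proof.
move: Z; apply: (PPop_coinv_span galP ffP) => [u v|u v|X x].
- by rewrite PPactD bis_evD.
- by rewrite bis_evD mulrDl.
- by rewrite -(aactM (PPact_action P)) !bis_ev_coinv mulrA.
Qed.

Lemma bis_ev_pure p q : bis_ev sigma (PPpure p q) = bis_aut sigma p * q.
Proof. by rewrite -bis_ev_act PPactE mul1r. Qed.

Lemma bis_ev_ES X : bis_ev sigma (ES_val X) = sigma X.
Proof.
by rewrite -[ES_val X](aact1 (PPact_action P)) bis_ev_coinv mulr1.
Qed.

Lemma bis_ev_linear : linear (bis_ev sigma).
Proof.
move=> a x y; rewrite bis_evD; congr (_ + _).
have -> : a *: x = PPact x (a%:A).
  have [_ r] := aact_bilinear (PPact_action P).
  by rewrite (linear_scale (r x)) (aact1 (PPact_action P)).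
by rewrite bis_ev_act -scalerAr mulr1.
Qed.

Lemma bis_aut_linear : linear (bis_aut sigma).
Proof.
by move=> a x y; rewrite /bis_aut (PPpure_bilinear P).1 bis_ev_linear.
Qed.

Lemma bis_aut_coinv (b : B) : bis_aut sigma b = sigma (s b).
Proof. by rewrite -bis_ev_ES. Qed.

Lemma PPact_mull (X Y : PPop P) y : PPact X y * Y = PPact (X * Y) y.
Proof. by rewrite /PPact mulrA. Qed.

Lemma PPact_left p (X : PPop P) y : PPpure p 1 * PPact X y =
  PPact (PPpure p 1 * X) y.
Proof. by rewrite /PPact !mulrA !PPpureM !mulr1 !mul1r. Qed.

(** Multiplication by p ⊗ 1 commutes with the right action of P, so it is
    enough to treat Z in L. There sigma(YZ) = sigma(Y t(sigma(Z))) replaces Z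
    by 1 ⊗ sigma(Z), for which the identity is the definition of F. *)
Lemma bis_ev_left p X : bis_ev sigma (PPpure p 1 * X) =
  bis_aut sigma p * bis_ev sigma X.
Proof.
have ES_case (Z : ES P) : bis_ev sigma (PPpure p 1 * ES_val Z) =
  bis_aut sigma p * (sigma Z : P).
  rewrite -bis_ev_pure -[PPpure p (sigma Z)]mul1r.
  have -> : 1 * PPpure p (sigma Z) = PPpure p 1 * ES_val (t (sigma Z)).
    by rewrite mul1r /= /PPop_target PPpureM mulr1 mulr1.
  move: (PPpure p 1); apply: (PPop_coinv_span galP ffP) => [u v|u v|Y y].
  - by rewrite mulrDl bis_evD.
  - by rewrite mulrDl bis_evD.
  - by rewrite !PPact_mull -!ES_valM !bis_ev_coinv (lbis_mulT sb).
move: X; apply: (PPop_coinv_span galP ffP) => [u v|u v|Z w].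
- by rewrite mulrDr bis_evD.
- by rewrite bis_evD mulrDr.
- by rewrite PPact_left bis_ev_act ES_case bis_ev_coinv mulrA.
Qed.

Lemma bis_aut_alg_map : alg_map (bis_aut sigma).
Proof.
split=> [|p q|]; first exact: bis_aut_linear.
  by rewrite -bis_ev_left PPpureM mulr1.
by rewrite /bis_aut -[PPpure 1 1]/(ES_val 1) bis_ev_ES (lbis_unit sb).
Qed.

(** On a product X y with X in L both sides are sigma(X) y_0 ⊗ y_1. *)
Lemma coact_bis_ev Z : coact (bis_ev sigma Z) =
  tmap (bis_ev sigma) idfun (diag_coact Z).
Proof.
have [cl _ _] := @coact_alg_map k H P.
have lt := linear_tmap bis_ev_linear (@linear_idfun k H).
have aB := aact_bilinear (PPact_action P).
move: Z; apply: (PPop_coinv_span galP ffP) => [u v|u v|X y].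
- by rewrite bis_evD (linear_add cl).
- by rewrite diag_coactD (linear_add lt).
rewrite bis_ev_coinv coactM coact_coinv diag_coact_act.
rewrite ((ES_coinv (ES_val X)).2 (ex_intro _ X erefl)).
rewrite tmap_hmul //; last exact: bis_ev_linear.
rewrite (eq_hmul (b' := fun m n => bis_ev sigma m * n)); last first.
  by move=> *; exact: bis_ev_act.
rewrite -(hmul_tmapl (b := mulP)) ?tmapE ?bis_ev_ES //;
  try exact: bis_ev_linear.
exact: bilinear_mul.
Qed.

Lemma bis_autP : Aut (bis_aut sigma).
Proof.
have [cl _ _] := @coact_alg_map k H P.
have c p : coact (bis_aut sigma p) = tmap (bis_aut sigma) idfun (coact p).
  have pl : linear (fun p : P => PPpure p 1) by exact: (PPpure_bilinear P).1.
  have l1 := linear_tmap bis_ev_linear (@linear_idfun k H).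
  have l2 := linear_tmap pl (@linear_idfun k H).
  rewrite /bis_aut coact_bis_ev diag_coact_left.
  move: (coact p); apply: tensk_ext.
  - exact: (linear_comp (f := tmap (bis_ev sigma) idfun)
      (g := tmap (fun p => PPpure p 1) idfun)).
  - by apply: linear_tmap => //; exact: bis_aut_linear.
  move=> x h; by rewrite !tmapE //;
    (exact: bis_aut_linear || exact: bis_ev_linear).
split=> //; split; first exact: bis_aut_alg_map.
apply: comod_alg_map_bij => //; first exact: bis_aut_alg_map.
have [am [psi phiK psiK]] := lbis_aut sb.
exists (sigma \o s), psi; split=> // b; exact: bis_aut_coinv.
Qed.

Lemma bis_ev_left_pairing X : bis_ev sigma X = left_pairing (bis_aut sigma) X.
Proof.
move: X; apply: PPop_ext => [u v|u v|p q].
- exact: bis_evD.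
- exact: left_pairingD bis_autP _ _.
- by rewrite bis_ev_pure (left_pairingE bis_autP).
Qed.

Lemma bis_autK : left_bis_of_aut (bis_aut sigma) = sigma.
Proof.
apply/funext => X; apply: coinv_val_inj.
by rewrite (left_bis_of_autE bis_autP) -bis_ev_left_pairing bis_ev_ES.
Qed.
End OneBisection.

(** F is recovered from its restriction to L because the map p ⊗ q |-> F(p) q
    is right P-linear. *)
Lemma left_pairing_inj F G : Aut F -> Aut G ->
  (forall X : ES P, left_pairing F (ES_val X) = left_pairing G (ES_val X)) ->
    F = G.
Proof.
move=> AF AG e; apply/funext => p.
rewrite -[F p]mulr1 -[G p]mulr1 -left_pairingE // -left_pairingE //.
move: (PPpure p 1); apply: (PPop_coinv_span galP ffP) => [||X y].
- exact: left_pairingD.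
- exact: left_pairingD.
- by rewrite !left_pairing_act // e.
Qed.

Lemma left_bis_of_aut_bijective : set_bij Aut [set sigma | left_bisection s t
  sigma] (@left_bis_of_aut k H P).
Proof.
split=> [F AF|F G|sigma sb].
- exact: left_bis_of_autP.
- rewrite !inE => AF AG e; apply: left_pairing_inj => // X.
  by rewrite -!left_bis_of_autE // e.
- by exists (bis_aut sigma); [exact: bis_autP | exact: bis_autK].
Qed.

(** The right bisection axioms give sigma(s(b)) = b and sigma(t(b) X) =
    sigma(s(sigma(X)) t(b)) = sigma(X) psi^-1(b), where s(B) and t(B) commute
    (here the inverse of sigma t is called psi). So psi sigma satisfies the
    first axiom of left bisections, restricts to psi along s, and the two
    multiplicativity axioms are exchanged. *)
Lemma right_to_left_bisection sigma psi :
  right_bisection s t sigma -> cancel (sigma \o t) psi ->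
    cancel psi (sigma \o t) ->
  left_bisection s t (psi \o sigma).
Proof.
move=> sb tK psiK; have [[[lt tM t1] _] [psi' [tK' psiK' mT]]]
  := (rbis_aut sb, rbis_mulT sb).
have psi'E b : psi' b = psi b by rewrite -[b]psiK tK' tK.
have ss b : sigma (s b) = b.
  by rewrite -[s b]mulr1 (rbis_source sb) (rbis_unit sb) mulr1.
have lpsi : linear psi.
  by move=> a x y; apply: (can_inj tK); rewrite lt !psiK.
have psiM b c : psi (b * c) = psi b * psi c.
  by apply: (can_inj tK); rewrite tM !psiK.
have psi1 : psi 1 = 1 by rewrite -t1 tK.
have st b c : s b * t c = t c * s b.
  by apply: ES_val_inj; rewrite !ES_valM /= /PPop_source /PPop_target
    !PPpureM !mul1r !mulr1.
split.
- by move=> a X Y /=; rewrite (rbis_linear sb) lpsi.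
- by rewrite /= (rbis_unit sb).
- move=> b X /=; rewrite (rbis_mulS sb) -st (rbis_source sb) psiM.
  by congr (_ * _); exact: tK.
- have E : (psi \o sigma) \o s =1 psi by move=> b; rewrite /= ss.
  split; last by exists (sigma \o t) => b; rewrite E; [exact: psiK | exact: tK].
  by split=> [a b c|b c|]; rewrite !E ?lpsi ?psiM ?psi1.
- by move=> X Y /=; rewrite mT psi'E.
- exists (sigma \o t); split=> [b|b|X Y].
  + by rewrite /= ss; exact: psiK.
  + by rewrite /= ss; exact: tK.
  + by rewrite /= (rbis_mulS sb) -{1}[sigma Y]psiK.
Qed.

(** F(G(p) q) = p F(q). *)
Lemma right_pairing_inv F G X : Aut F -> Aut G -> cancel F G -> cancel G F ->
  right_pairing F X = F (left_pairing G X).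
Proof.
move=> AF AG FK GK; have [[[lF FM F1] _] _] := AF.
move: X; apply: PPop_ext => [u v|u v|p q].
- exact: right_pairingD.
- by rewrite left_pairingD // (linear_add lF).
- by rewrite right_pairingE // left_pairingE // FM GK.
Qed.

(** F restricts on B to sigma t, hence is determined there by sigma; applying
    F^-1 then reduces injectivity to left bisections, and surjectivity is
    [right_to_left_bisection]. *)
Lemma right_bis_of_aut_bijective : set_bij Aut [set sigma | right_bisection s
  t sigma] (@right_bis_of_aut k H P).
Proof.
split=> [F AF|F G|sigma sb].
- exact: right_bis_of_autP.
- rewrite !inE => AF AG e.
  have [[_ [F' FK F'K]] _] := AF; have [[_ [G' GK G'K]] _] := AG.
  have AF' := aut_inv AF FK F'K; have AG' := aut_inv AG GK G'K.
  have FGB (b : B) : F b = G b by rewrite -!right_bis_of_aut_target // e.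
  suff E : F' = G' by apply/funext => p; rewrite -[LHS]G'K -E FK.
  apply: left_pairing_inj => // X; apply: (can_inj FK).
  rewrite -(right_pairing_inv _ AF AF')
    // -right_bis_of_autE // e right_bis_of_autE //.
  rewrite (right_pairing_inv _ AG AG') //.
  by rewrite -left_bis_of_autE // FGB.
- have [[_ [psi tK psiK]] _] := (rbis_aut sb, tt).
  have lb := right_to_left_bisection sb tK psiK.
  have AF := bis_autP lb; set F := bis_aut _ in AF.
  have [[_ [G FK GK]] _] := AF; have AG := aut_inv AF FK GK.
  exists G => //; apply/funext => X; apply: coinv_val_inj.
  rewrite right_bis_of_autE // (right_pairing_inv _ AG AF)
    // -(bis_ev_left_pairing lb) bis_ev_ES //=.
  have ss b : sigma (s b) = b.
    by rewrite -[s b]mulr1 (rbis_source sb) (rbis_unit sb) mulr1.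
  apply: (can_inj FK); rewrite GK /F.
  by rewrite bis_aut_coinv //= ss.
Qed.

End FromBisections.

(** * The coproduct and the products of bisections *)

Lemma morph_tlift (A : Type) (M N W W' : zmodType) (r : M -> A ->
  M) (l : A -> N -> N)
    (f : M -> N -> W) (g : W -> W') (x : tens r l) : {morph g : u v / u + v} ->
  g (tlift f x) = tlift (fun m n => g (f m n)) x.
Proof. by move=> gD; apply: (big_morph g gD); exact: morph0. Qed.

Section TripleTensor.
Variables (k : fieldType) (H : hopfAlgType k) (P : comodAlgType H).
Local Notation B := (coinv P).

Definition PPP : algType k := (PPop P ⊗ P)%type.
Definition PPPpure (X : PPop P) (q : P) : PPP := purek X q.
(** P acts on the last factor of P ⊗ P ⊗ P. *)
Definition PPPact (x : PPP) (y : P) : PPP := x * PPPpure 1 y.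

Lemma PPPpure_bilinear : bilinear_map PPPpure.
Proof. exact: (@purek_bilinear k (PPop P) P). Qed.

Lemma PPPactE X q y : PPPact (PPPpure X q) y = PPPpure X (q * y).
Proof. by rewrite /PPPact [LHS]purekM mulr1. Qed.

Lemma PPPact_action : algebra_action PPPact.
Proof.
split=> [|m x y|m].
- exact: (bilinear_comp2 (g := idfun) (@bilinear_mul k PPP)
    _ (PPPpure_bilinear.2 1)).
- by rewrite /PPPact -mulrA [PPPpure 1 x * _]purekM mulr1.
- exact: mulr1.
Qed.

Lemma PPP_ext (W : zmodType) (f g : PPP -> W) :
  {morph f : x y / x + y} -> {morph g : x y / x + y} ->
  (forall X q, f (PPPpure X q) = g (PPPpure X q)) -> f =1 g.
Proof. exact: tensk_ext_additive. Qed.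

Definition PPPcoact : PPP -> PPP ⊗ H :=
  klift (fun (X : PPop P) (q : P) => hmul PPPpure (diag_coact X) (coact q)).

Lemma PPPcoact_bilinear :
  bilinear_map (fun (X : PPop P) (q : P) => hmul PPPpure (diag_coact X)
    (coact q)).
Proof.
have [cl _ _] := @coact_alg_map k H P.
exact: (bilinear_comp2 (hmul_bilinear H PPPpure_bilinear)
  (@diag_coact_linear k H P)).
Qed.

Lemma PPPcoact_linear : linear PPPcoact.
Proof. exact: klift_linear PPPcoact_bilinear. Qed.

Lemma PPPcoactE X q : PPPcoact (PPPpure X q) =
  hmul PPPpure (diag_coact X) (coact q).
Proof. exact: kliftE PPPcoact_bilinear _ _. Qed.

Lemma PPPcoact_act x y : PPPcoact (PPPact x y) =
  hmul PPPact (PPPcoact x) (coact y).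
Proof.
have aB := aact_bilinear PPPact_action; have hb := hmul_bilinear H aB.
move: x; apply: PPP_ext => [u v|u v|X q].
- by rewrite (linear_add (aB.1 _)) (linear_add PPPcoact_linear).
- by rewrite (linear_add PPPcoact_linear) (linear_add (hb.1 _)).
rewrite PPPactE !PPPcoactE coactM.
rewrite (hmulA (b3 := fun x y : P => x * y) (b4 := PPPpure)) //.
- exact: PPPpure_bilinear.
- exact: bilinear_mul.
- exact: PPPpure_bilinear.
- exact: PPPactE.
Qed.

Definition PPPcoinv_pred : {pred PPP} := fun x => `[< PPPcoact x =
  x ⊗ (1 : H) >].

Lemma PPPcoinv_closed : zmod_closed PPPcoinv_pred.
Proof.
have l := PPPcoact_linear; have l' := @linear_purel k PPP H 1.
split; first by apply/asboolP; rewrite (linear_zero l) (linear_zero l').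
move=> x y /asboolP ex /asboolP ey; apply/asboolP.
by rewrite (linear_add l) (linear_opp l) ex ey (linear_add l') (linear_opp l').
Qed.

Record PPPcoinv : Type :=
  MkPPPcoinv { PPPcoinv_val :> PPP; _ : PPPcoinv_val \in PPPcoinv_pred }.

HB.instance Definition _ := [isSub for PPPcoinv_val].
HB.instance Definition _ := [Choice of PPPcoinv by <:].
HB.instance Definition _ :=
  GRing.SubChoice_isSubZmodule.Build PPP PPPcoinv_pred PPPcoinv PPPcoinv_closed.

Lemma PPPcoinv_valD : {morph PPPcoinv_val : x y / x + y}.
Proof. exact: raddfD (val : PPPcoinv -> PPP). Qed.

Lemma PPPcoinvP (x : PPPcoinv) : PPPcoact x = (x : PPP) ⊗ (1 : H).
Proof. by case: x => x /= /asboolP. Qed.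

Lemma PPPcoinv_act_in (x : PPPcoinv) (b : B) : PPPact x b \in PPPcoinv_pred.
Proof.
apply/asboolP; rewrite PPPcoact_act PPPcoinvP coact_coinv.
by rewrite hmulE ?mulr1 //; exact: aact_bilinear PPPact_action.
Qed.

Definition PPPcoinv_right (x : PPPcoinv) (b : B) : PPPcoinv :=
  MkPPPcoinv (PPPcoinv_act_in x b).

Lemma PPPcoinv_right_action : right_action PPPcoinv_right.
Proof.
have R := coinv_res_action PPPact_action.
split=> *; apply: (@val_inj _ _ PPPcoinv); rewrite /= ?PPPcoinv_valD.
- exact: ractDl R _ _ _.
- exact: ractDr R _ _ _.
- exact: ractM R _ _ _.
- exact: ract1 R _.
Qed.

Lemma PPP_coinv (x : PPP) :
  PPPcoact x = x ⊗ (1 : H) <-> exists x0 : PPPcoinv, (x0 : PPP) = x.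
Proof.
split=> [e|[x0 <-]]; last exact: PPPcoinvP.
by have xE : x \in PPPcoinv_pred by [exact/asboolP]; exists (MkPPPcoinv xE).
Qed.

Hypotheses (galP : hopf_galois P) (ffP : faithfully_flat (@coinv_act k H P)).

Local Notation muT := (coinv_mul PPPact PPPcoinv_right PPPcoinv_val).

Lemma PPP_muE x y : muT (pure _ _ x y) = PPPact x y.
Proof. exact: (coinv_mulE PPPact_action PPPcoinv_valD). Qed.

Lemma PPP_muD : {morph muT : x y / x + y}.
Proof. exact: (coinv_mulD PPPact_action PPPcoinv_valD). Qed.

Lemma PPP_mu_inj : injective muT.
Proof.
apply: (coinv_mul_inj PPPact_action PPPcoact_linear PPPcoact_act
  PPPcoinv_right_action PPPcoinv_valD _ _ PPP_coinv galP ffP) => //.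
exact: (@val_inj _ _ PPPcoinv).
Qed.

(** (a ⊗ x, r ⊗ z) |-> a ⊗ xr ⊗ z. *)
Definition contract (X Y : PPop P) : PPP :=
  klift (fun (r : P) (z : P^c) => PPPpure (PPact X r) (z : P)) Y.

Lemma contract_pre X : bilinear_map (fun r z : P => PPPpure (PPact X r) z).
Proof.
exact: (bilinear_comp2 (h := idfun)
  PPPpure_bilinear ((aact_bilinear (PPact_action P)).2 X)).
Qed.

Lemma contractE X r z : contract X (PPpure r z) = PPPpure (PPact X r) z.
Proof. exact: (@kliftE k P P^c PPP (fun r z : P => PPPpure (PPact X r) z)
  (contract_pre X)). Qed.

Lemma contract_bilinear : bilinear_map contract.
Proof.
split=> [Y|X]; last first.
  exact: (@klift_linear k P P^c PPP (fun r z : P => PPPpure (PPact X r) z)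
    (contract_pre X)).
move=> a X X'; rewrite /contract -klift_scaleadd; apply: eq_klift => r z.
by rewrite (aact_bilinear (PPact_action P)).1 PPPpure_bilinear.1.
Qed.

Lemma contract_act X Y y : contract X (PPact Y y) = PPPact (contract X Y) y.
Proof.
have lc := contract_bilinear.2 X; have la := (aact_bilinear PPPact_action).1 y.
move: Y; apply: PPop_ext => [u v|u v|r z].
- by rewrite PPactD (linear_add lc).
- by rewrite (linear_add lc) (linear_add la).
- by rewrite PPactE !contractE PPPactE.
Qed.

Lemma contract_balanced X c Y :
  contract (PPop_target c * X) Y = contract X (PPop_source c * Y).
Proof.
have lc Z := linear_add (contract_bilinear.2 Z).
move: Y; apply: PPop_ext => [u v|u v|r z].
- by rewrite lc.
- by rewrite mulrDr lc.
- by rewrite PPpureM mulr1 !contractE (aactM (PPact_action P)).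
Qed.

(** For X = a ⊗ x coinvariant, only r ⊗ z contributes to the coaction of a ⊗
    xr ⊗ z. *)
Lemma PPPcoact_contract (X : ES P) (Y : PPop P) :
  PPPcoact (contract (ES_val X) Y) =
  hmul contract (ES_val X ⊗ (1 : H)) (diag_coact Y).
Proof.
have lc := contract_bilinear.2 (ES_val X); have lP := PPPcoact_linear.
have hb := hmul_bilinear H contract_bilinear.
move: Y; apply: PPop_ext => [u v|u v|r z].
- by rewrite (linear_add lc) (linear_add lP).
- by rewrite diag_coactD (linear_add (hb.2 _)).
rewrite contractE PPPcoactE diag_coact_act diag_coact_pure.
rewrite ((ES_coinv (ES_val X)).2 (ex_intro _ X erefl)).
apply: hmulA.
- exact: aact_bilinear (PPact_action P).
- exact: PPPpure_bilinear.
- exact: PPpure_bilinear.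
- exact: contract_bilinear.
- by move=> *; rewrite contractE.
Qed.

Lemma contract_coinv_in (X Y : ES P) :
  contract (ES_val X) (ES_val Y) \in PPPcoinv_pred.
Proof.
apply/asboolP; rewrite PPPcoact_contract ((ES_coinv (ES_val Y)).2 (ex_intro _
  Y erefl)).
by rewrite hmulE ?mulr1 //; exact: contract_bilinear.
Qed.

Local Notation LL := (bimod_tens (@ES_source k H P) (@ES_target k H P)).
Local Notation PP2 := (bimod_tens (@PPop_source k H P) (@PPop_target k H P)).

Definition LLcontract : LL -> PPPcoinv :=
  tlift (fun X Y => MkPPPcoinv (contract_coinv_in X Y)).

Lemma LLcontract_balanced :
  balanced (fun (X : ES P) (c : B) => ES_target c * X) (fun (b : B)
    (X : ES P) => ES_source b * X)
   (fun X Y => MkPPPcoinv (contract_coinv_in X Y)).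
Proof.
have cb := contract_bilinear.
split=> [X X' Y|X Y Y'|X c Y]; apply: (@val_inj _ _ PPPcoinv).
- rewrite [RHS]PPPcoinv_valD -[LHS]/(contract (ES_val (X + X')) (ES_val Y)).
  by rewrite ES_valD (linear_add (cb.1 _)).
- rewrite [RHS]PPPcoinv_valD -[LHS]/(contract (ES_val X) (ES_val (Y + Y'))).
  by rewrite ES_valD (linear_add (cb.2 _)).
- rewrite -[LHS]/(contract (ES_val (ES_target c * X)) (ES_val Y)).
  rewrite -[RHS]/(contract (ES_val X) (ES_val (ES_source c * Y))).
  by rewrite !ES_valM contract_balanced.
Qed.

Lemma LLcontractE X Y : LLcontract (bimod_pure _ _ X Y) =
  contract (ES_val X) (ES_val Y) :> PPP.
Proof. by rewrite /LLcontract (tliftE LLcontract_balanced). Qed.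

Lemma LLcontractD : {morph LLcontract : x y / x + y}.
Proof. exact: tliftD LLcontract_balanced. Qed.

Definition LLright (w : LL) (c : B) : LL :=
  tlift (fun X Y => bimod_pure (@ES_source k H P) (@ES_target k H P)
    X (ES_target c * Y)) w.

Lemma ES_source_targetC (b c : B) :
  ES_source b * ES_target c = ES_target c * ES_source b :> ES P.
Proof.
by apply: ES_val_inj; rewrite !ES_valM /= /PPop_source /PPop_target !PPpureM
  !mul1r !mulr1.
Qed.

Lemma LLright_balanced c :
  balanced (fun (X : ES P) (c : B) => ES_target c * X) (fun (b : B)
    (X : ES P) => ES_source b * X)
   (fun X Y => bimod_pure (@ES_source k H P) (@ES_target k H P)
     X (ES_target c * Y)).
Proof.
split=> *.
- exact: pureDl.
- by rewrite mulrDr; exact: pureDr.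
- by rewrite mulrA -ES_source_targetC -mulrA; exact: pure_bal.
Qed.

Lemma LLrightE c X Y : LLright (bimod_pure _ _ X Y) c =
  bimod_pure _ _ X (ES_target c * Y).
Proof. exact: tliftE (LLright_balanced c) _ _. Qed.

Lemma LLrightD c : {morph LLright^~ c : x y / x + y}.
Proof. exact: tliftD (LLright_balanced c). Qed.

Lemma LLright_action : right_action LLright.
Proof.
split=> [w w' c|w b c|w b c|w]; first exact: LLrightD.
- rewrite -[RHS]tlift_addfun; apply: eq_tlift => X Y.
  by rewrite ES_targetD mulrDl; exact: pureDr.
- move: w; apply: tens_ext => [u v|u v|X Y]; try by rewrite !LLrightD.
  by rewrite !LLrightE ES_targetM mulrA.
- move: w; apply: tens_ext => [u v|//|X Y]; first exact: LLrightD.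
  by rewrite LLrightE ES_target1 mul1r.
Qed.

Lemma LLcontract_right w c : LLcontract (LLright w c) =
  PPPcoinv_right (LLcontract w) c.
Proof.
apply: (@val_inj _ _ PPPcoinv) => /=.
move: w; apply: tens_ext => [u v|u v|X Y].
- by rewrite LLrightD LLcontractD PPPcoinv_valD.
- by rewrite LLcontractD PPPcoinv_valD (linear_add ((aact_bilinear
    PPPact_action).1 _)).
- rewrite LLrightE !LLcontractE ES_valM /= .
  exact: contract_act.
Qed.

(** After tensoring with P over B, the target embeds into P ⊗ P ⊗ P, and
    applying L ⊗_B P = P ⊗ P to both copies of L shows that everything there
    is attained. *)
Lemma LLcontract_surj x : exists w, LLcontract w = x.
Proof.
move: x; apply: (faithfully_flat_surjective ffP LLright_action
  PPPcoinv_right_action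
  LLcontractD LLcontract_right) => v.
pose tm := tensmap (l := @coinv_act k H P) (r := LLright)
  PPPcoinv_right LLcontract.
have tD : {morph tm : x y / x + y} := tensmapD LLcontractD LLcontract_right.
suff im x : exists w, muT (tm w) = x.
  by have [w /PPP_mu_inj wE] := im (muT v); exists w.
have im0 : exists w, muT (tm w) = 0.
  by exists 0; rewrite (morph0 tD) (morph0 PPP_muD).
have imD x1 x2 : (exists w, muT (tm w) = x1) -> (exists w, muT (tm w) = x2) ->
    exists w, muT (tm w) = x1 + x2.
  by move=> [w <-] [w' <-]; exists (w + w'); rewrite tD PPP_muD.
have im_contract (X : ES P) Y : exists w, muT (tm w) = contract (ES_val X) Y.
  have lc := contract_bilinear.2 (ES_val X).
  have [w <-] := ES_mu_surj galP ffP Y; move: w;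
    apply: tens_ind => [|x1 x2|Z y].
  - by rewrite (morph0 (@ES_muD k H P)) (linear_zero lc).
  - by rewrite ES_muD (linear_add lc); exact: imD.
  - exists (pure _ _ (bimod_pure _ _ X Z) y).
    rewrite ES_muE contract_act /tm (tensmapE _ LLcontractD LLcontract_right).
    by rewrite PPP_muE LLcontractE.
move: x; apply: tens_ind => // Z q.
rewrite -[pure _ _ Z q]/(PPPpure Z q).
have lp := PPPpure_bilinear.1 q.
have [w <-] := ES_mu_surj galP ffP Z; move: w; apply: tens_ind => [|x1 x2|X y].
- by rewrite (morph0 (@ES_muD k H P)) (linear_zero lp).
- by rewrite ES_muD (linear_add lp); exact: imD.
- by rewrite ES_muE -contractE.
Qed.

(** p ⊗ q |-> p ⊗ 1 ⊗ q. *)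
Definition insert_mid (X : PPop P) : PPP :=
  klift (fun (p : P) (q : P^c) => PPPpure (PPpure p 1) (q : P)) X.

Lemma insert_mid_pre : bilinear_map (fun p q : P => PPPpure (PPpure p 1) q).
Proof.
exact: (bilinear_comp2 (h := idfun) PPPpure_bilinear ((PPpure_bilinear P).1 1)).
Qed.

Lemma insert_mid_linear : linear insert_mid.
Proof. exact: (@klift_linear k P P^c PPP _ insert_mid_pre). Qed.

Lemma insert_midE p q : insert_mid (PPpure p q) = PPPpure (PPpure p 1) q.
Proof. exact: (@kliftE k P P^c PPP _ insert_mid_pre). Qed.

Lemma PPPcoact_insert_mid X :
  PPPcoact (insert_mid X) = tmap insert_mid idfun (diag_coact X).
Proof.
have li := insert_mid_linear; have lt := linear_tmap li (@linear_idfun k H).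
move: X; apply: PPop_ext => [u v|u v|p q].
- by rewrite (linear_add li) (linear_add PPPcoact_linear).
- by rewrite diag_coactD (linear_add lt).
rewrite insert_midE PPPcoactE diag_coact_left diag_coact_pure.
rewrite hmul_tmapl ?tmap_hmul //.
- by apply: eq_hmul => p' q'; rewrite insert_midE.
- exact: PPpure_bilinear.
- exact: PPPpure_bilinear.
- exact: (PPpure_bilinear P).1.
Qed.

Lemma insert_mid_coinv (X : ES P) : exists w, LLcontract w =
  insert_mid (ES_val X) :> PPP.
Proof.
have /PPP_coinv[x xE] : PPPcoact (insert_mid (ES_val X)) =
  insert_mid (ES_val X) ⊗ (1 : H).
  rewrite PPPcoact_insert_mid ((ES_coinv (ES_val X)).2 (ex_intro _ X erefl)).
  by rewrite tmapE //; exact: insert_mid_linear.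
by have [w wE] := LLcontract_surj x; exists w; rewrite wE.
Qed.

(** The inverse of L ⊗_B P -> P ⊗ P followed by the inclusion into (P ⊗ P) ⊗_B
    P. Going through the coaction gives it by a formula in the translation
    map, comparable with the definition of the coproduct. *)
Definition PPsplit (Z : PPop P) : tens (coinv_res (@PPact k H P))
  (@coinv_act k H P) :=
  module_galois_inv (@PPact k H P) (diag_coact Z).

Lemma PPsplitD : {morph PPsplit : x y / x + y}.
Proof. by move=> x y; rewrite /PPsplit diag_coactD (module_galois_invD galP
  (PPact_action P)). Qed.

Lemma PPsplit_coinv (X : ES P) y :
  PPsplit (PPact (ES_val X) y) = pure _ _ (ES_val X) y.
Proof.
rewrite /PPsplit diag_coact_act ((ES_coinv (ES_val X)).2 (ex_intro _ X erefl)).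
by rewrite -module_galoisE ?module_galoisK //; exact: PPact_action.
Qed.

(** Z ⊗ y |-> Z ⊗ (y ⊗ q). *)
Definition append_right (q : P) :
    tens (coinv_res (@PPact k H P)) (@coinv_act k H P) -> PP2 :=
  tlift (fun Z y => bimod_pure _ _ Z (PPpure y q)).

Lemma append_right_balanced q :
  balanced (coinv_res (@PPact k H P)) (@coinv_act k H P)
    (fun Z y => bimod_pure (@PPop_source k H P) (@PPop_target k H P)
      Z (PPpure y q)).
Proof.
split=> *; first exact: pureDl.
  by rewrite (linear_add ((PPpure_bilinear P).1 _)); exact: pureDr.
by rewrite [LHS]pure_bal /coinv_act /PPop_source PPpureM mulr1.
Qed.

Lemma append_rightE q Z y : append_right q (pure _ _ Z y) =
  bimod_pure _ _ Z (PPpure y q).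
Proof. exact: tliftE (append_right_balanced q) _ _. Qed.

Lemma append_rightD q : {morph append_right q : x y / x + y}.
Proof. exact: tliftD (append_right_balanced q). Qed.

Lemma append_rightDl q q' w :
  append_right (q + q') w = append_right q w + append_right q' w.
Proof.
rewrite -[RHS]tlift_addfun; apply: eq_tlift => Z y.
by rewrite (linear_add ((PPpure_bilinear P).2 _)); exact: pureDr.
Qed.

(** Z ⊗ q |-> the splitting of Z with q appended. It recovers an element of L
    ⊗_B L from its contraction, and maps p ⊗ 1 ⊗ q to the formal coproduct of
    p ⊗ q. *)
Definition PPP_to_PP2 : PPP -> PP2 :=
  tlift (fun (Z : PPop P) (q : P) => append_right q (PPsplit Z)).

Lemma PPP_to_PP2_balanced :
  balanced (fun (u : PPop P) (a : k) => a *: u) (fun (a : k) (v : P) => a *: v)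
    (fun (Z : PPop P) (q : P) => append_right q (PPsplit Z)).
Proof.
split=> [Z Z' q|Z q q'|Z a q]; first by rewrite PPsplitD append_rightD.
  exact: append_rightDl.
move: Z; apply: (PPop_coinv_span galP ffP) => [u v|u v|X y].
- by rewrite scalerDr PPsplitD append_rightD.
- by rewrite PPsplitD append_rightD.
rewrite -(linear_scale ((aact_bilinear (PPact_action P)).2 _))
  !PPsplit_coinv !append_rightE.
congr bimod_pure.
by rewrite (linear_scale ((PPpure_bilinear P).1 _))
  (linear_scale ((PPpure_bilinear P).2 _)).
Qed.

Lemma PPP_to_PP2E Z q : PPP_to_PP2 (PPPpure Z q) = append_right q (PPsplit Z).
Proof. exact: tliftE PPP_to_PP2_balanced _ _. Qed.

Lemma PPP_to_PP2D : {morph PPP_to_PP2 : x y / x + y}.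
Proof. exact: tliftD PPP_to_PP2_balanced. Qed.

Lemma PPP_to_PP2_contract (w : LL) : PPP_to_PP2 (LLcontract w) = ES_tens_val w.
Proof.
have vb : balanced (fun (X : ES P) (c : B) => ES_target c * X)
    (fun (b : B) (X : ES P) => ES_source b * X)
    (fun X Y : ES P => bimod_pure (@PPop_source k H P) (@PPop_target k H P)
      (ES_val X) (ES_val Y)).
  split=> *; rewrite ?ES_valD ?ES_valM;
    [exact: pureDl|exact: pureDr|exact: pure_bal].
move: w; apply: tens_ext => [u v|u v|X Y].
- by rewrite LLcontractD PPPcoinv_valD PPP_to_PP2D.
- exact: (tliftD vb).
rewrite LLcontractE [RHS](tliftE vb).
have lc := contract_bilinear.2 (ES_val X).
move: (ES_val Y); apply: PPop_ext => [u v|u v|r z].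
- by rewrite (linear_add lc) PPP_to_PP2D.
- exact: pureDr.
- by rewrite contractE PPP_to_PP2E PPsplit_coinv append_rightE.
Qed.

Lemma PPsplit_left p : PPsplit (PPpure p 1) =
  tlift (fun (p0 : P) (h : H) => tlift (fun x y => pure _ _ (PPpure p0 x) y)
    (translation P h)) (coact p).
Proof.
have kb := module_galois_inv_balanced galP (PPact_action P).
rewrite /PPsplit diag_coact_left.
rewrite [module_galois_inv _ _](morph_tlift _ _ (module_galois_invD galP
  (PPact_action P))).
apply: eq_tlift => p0 h; rewrite module_galois_invE //;
  last exact: PPact_action.
by apply: eq_tlift => x y; rewrite PPactE mul1r.
Qed.

Lemma PPP_to_PP2_insert_mid X : PPP_to_PP2 (insert_mid X) = PPop_coprod X.
Proof.
rewrite [LHS](morph_tlift _ _ PPP_to_PP2D); apply: eq_tlift => p q.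
rewrite PPP_to_PP2E PPsplit_left (morph_tlift _ _ (append_rightD q)).
apply: eq_tlift => p0 h; rewrite (morph_tlift _ _ (append_rightD q)).
by apply: eq_tlift => x y; rewrite append_rightE.
Qed.

(** An element of L ⊗_B L with contraction p ⊗ 1 ⊗ q has the formal coproduct
    as its image in (P ⊗ P) ⊗_B (P ⊗ P). *)
Lemma ES_coprodP (X : ES P) : ES_tens_val (ES_coprod X) =
  PPop_coprod (ES_val X).
Proof.
apply: (@xgetPex _ 0 [set Y | ES_tens_val Y = PPop_coprod (ES_val X)]).
have [w wE] := insert_mid_coinv X; exists w.
by rewrite /= -PPP_to_PP2_contract wE PPP_to_PP2_insert_mid.
Qed.

(** An additive map on (P ⊗ P) ⊗_B (P ⊗ P) that only depends on X y and q on
    elements X ⊗ (y ⊗ q) takes on the coproduct of p ⊗ q the value at p ⊗ 1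
    and q, because the elements X ⊗ y representing p ⊗ 1 have product p ⊗ 1. *)
Lemma ES_coprod_eval (W : zmodType) (Theta : PP2 -> W) (kap : PPop P -> P ->
  W) :
  {morph Theta : x y / x + y} -> (forall q, {morph kap^~ q : x y / x + y}) ->
  (forall (X : ES P) y q, Theta (bimod_pure _ _ (ES_val X) (PPpure y q)) =
    kap (PPact (ES_val X) y) q) ->
  forall X : ES P, Theta (ES_tens_val (ES_coprod X)) =
    tlift (fun (p : P) (q : P^c) => kap (PPpure p 1) q) (ES_val X).
Proof.
move=> TD kD TE X; rewrite ES_coprodP -PPP_to_PP2_insert_mid.
rewrite [PPP_to_PP2 _](morph_tlift _ _ PPP_to_PP2D) (morph_tlift _ _ TD).
apply: eq_tlift => p q; rewrite PPP_to_PP2E.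
move: (PPpure p 1); apply: (PPop_coinv_span galP ffP) => [u v|u v|Y y].
- by rewrite PPsplitD append_rightD TD.
- exact: kD.
- by rewrite PPsplit_coinv append_rightE TE.
Qed.

Local Notation Aut := (@comod_alg_aut k H P).

(** The integrand extends to Z ⊗ W |-> F~(G~(Z) W), with F~(p ⊗ q) = F(p) q,
    and takes the value F(G(p)) q on the coproduct of p ⊗ q. *)
Lemma left_bis_mul_of_aut F G : Aut F -> Aut G ->
  left_bis_mul (@ES_coprod k H P) (left_bis_of_aut F) (left_bis_of_aut G) =
    left_bis_of_aut (F \o G).
Proof.
move=> AF AG; have AFG := aut_comp AF AG; apply/funext => X;
  apply: coinv_val_inj.
have [[[lF FM F1] _] _] := AF; have [[[lG GM G1] _] _] := AG.
rewrite left_bis_of_autE // /left_bis_mul (morph_tlift _ _ (@coinv_valD k H P)).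
pose th (Z W : PPop P) := left_pairing F (PPpure (left_pairing G Z) 1 * W).
have thb : balanced (fun (X : PPop P) (c : B) => PPop_target c * X)
    (fun (b : B) (X : PPop P) => PPop_source b * X) th.
  split=> [Z Z' W|Z W W'|Z c W]; rewrite /th.
  - by rewrite left_pairingD // (linear_add ((PPpure_bilinear P).1 _))
      mulrDl left_pairingD.
  - by rewrite mulrDr left_pairingD.
  - rewrite /PPop_source /PPop_target (left_pairing_mul AG)
      G1 mul1r mulrA PPpureM.
    by rewrite mulr1.
pose Th : PP2 -> P := tlift th.
have ThD : {morph Th : x y / x + y} := tliftD thb.
transitivity (Th (ES_tens_val (ES_coprod X))).
  rewrite /ES_tens_val (morph_tlift _ _ ThD); apply: eq_tlift => X1 X2.
  by rewrite /Th (tliftE thb) /th left_bis_of_autE // ES_valM /= /PPop_source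
    left_bis_of_autE.
rewrite (ES_coprod_eval ThD (kap := fun Z q => F (left_pairing G Z) * q)).
- by apply: eq_tlift => p q; rewrite left_pairingE // mulr1.
- by move=> q Z Z' /=; rewrite left_pairingD // (linear_add lF) mulrDl.
- move=> Y y q; rewrite /Th (tliftE thb) /th PPpureM mulr1 left_pairingE //.
  by rewrite left_pairing_act.
Qed.

(** As for left bisections, now with F~(p ⊗ q) = p F(q) and the integrand Z ⊗
    W |-> F~(Z G~(W)). *)
Lemma right_bis_mul_of_aut F G : Aut F -> Aut G ->
  right_bis_mul (@ES_coprod k H P) (right_bis_of_aut F) (right_bis_of_aut G)
    = right_bis_of_aut (F \o G).
Proof.
move=> AF AG; have AFG := aut_comp AF AG; apply/funext => X;
  apply: coinv_val_inj.
have [[[lF FM F1] _] _] := AF; have [[[lG GM G1] _] _] := AG.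
rewrite right_bis_of_autE // /right_bis_mul (morph_tlift _ _ (@coinv_valD k H
  P)).
pose th (Z W : PPop P) := right_pairing F (PPact Z (right_pairing G W)).
have thb : balanced (fun (X : PPop P) (c : B) => PPop_target c * X)
    (fun (b : B) (X : PPop P) => PPop_source b * X) th.
  split=> [Z Z' W|Z W W'|Z c W]; rewrite /th.
  - by rewrite PPactD right_pairingD.
  - by rewrite right_pairingD // (linear_add ((aact_bilinear (PPact_action
      P)).2 _)) right_pairingD.
  - by rewrite /PPop_source (right_pairing_mul AG)
      G1 mulr1 -(aactM (PPact_action P)).
pose Th : PP2 -> P := tlift th.
have ThD : {morph Th : x y / x + y} := tliftD thb.
transitivity (Th (ES_tens_val (ES_coprod X))).
  rewrite /ES_tens_val (morph_tlift _ _ ThD); apply: eq_tlift => X1 X2.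
  by rewrite /Th (tliftE thb) /th right_bis_of_autE // ES_valM /=
    /PPop_target right_bis_of_autE.
rewrite (ES_coprod_eval ThD (kap := fun Z q => right_pairing F (PPact Z (G
  q)))).
- by apply: eq_tlift => p q; rewrite PPactE mul1r right_pairingE.
- by move=> q Z Z' /=; rewrite PPactD right_pairingD.
- move=> Y y q; rewrite /Th (tliftE thb) /th right_pairingE //.
  by rewrite (aactM (PPact_action P)).
Qed.

End TripleTensor.

(** * Transport of the group structure *)

Section Transport.
Variables (T1 T2 : Type) (G1 : set T1) (op1 : T1 -> T1 -> T1) (e1 : T1).
Variables (G2 : set T2) (op2 : T2 -> T2 -> T2) (f : T1 -> T2).
Hypotheses (grp1 : is_group G1 op1 e1) (fbij : set_bij G1 G2 f).
Hypothesis fM : forall x y, G1 x -> G1 y -> op2 (f x) (f y) = f (op1 x y).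

Lemma group_transport : is_group G2 op2 (f e1).
Proof.
have [fG finj fsurj] := fbij; case: grp1 => cl id1 A l r inv.
split=> [x y|||||].
- by move=> /fsurj[a Ga <-] /fsurj[b Gb <-]; rewrite fM //; apply: fG;
    exact: cl.
- exact: fG.
- move=> _ _ _ /fsurj[a Ga <-] /fsurj[b Gb <-] /fsurj[c Gc <-].
  by rewrite !fM //; [rewrite A| exact: cl|exact: cl].
- by move=> _ /fsurj[a Ga <-]; rewrite fM // l.
- by move=> _ /fsurj[a Ga <-]; rewrite fM // r.
- move=> _ /fsurj[a Ga <-]; have [b [Gb ab ba]] := inv a Ga.
  by exists (f b); split; [exact: fG | rewrite fM // ab | rewrite fM // ba].
Qed.

Lemma group_isomorphic_transport : group_isomorphic G1 op1 e1 G2 op2 (f e1).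
Proof.
split; [exact: grp1 | exact: group_transport |].
by exists f => // x y Gx Gy; rewrite fM.
Qed.

Lemma group_isomorphic_transport_sym : group_isomorphic G2 op2 (f e1) G1 op1 e1.
Proof.
have [fG finj fsurj] := fbij; have [cl _ _ _ _ _] := grp1.
split; [exact: group_transport | exact: grp1 |].
have /choice[g gP] : forall y, exists x, G2 y -> G1 x /\ f x = y.
  move=> y; have [/fsurj[x Gx fx]|nG] := EM (G2 y); first by exists x.
  by exists e1.
have gK x : G1 x -> g (f x) = x.
  move=> Gx; have [Gg fg] := gP _ (fG _ Gx).
  by apply: finj; rewrite ?inE.
exists g.
  split=> [y /gP[] //|y z|x Gx].
    by rewrite !inE => /gP[_ {2}<-] /gP[_ {2}<-] ->.
  by exists (f x); [exact: fG | exact: gK].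
move=> y z /gP[Gy {1}<-] /gP[Gz {1}<-].
by rewrite fM // gK //; exact: cl.
Qed.
End Transport.

Section IdCounit.
Variables (k : fieldType) (H : hopfAlgType k) (P : comodAlgType H).

Lemma left_bis_of_aut_id : left_bis_of_aut idfun = @ES_counit k H P.
Proof.
apply/funext => X; apply: coinv_val_inj.
rewrite left_bis_of_autE; first by []. by have [] := aut_group P.
Qed.

Lemma right_bis_of_aut_id : right_bis_of_aut idfun = @ES_counit k H P.
Proof.
apply/funext => X; apply: coinv_val_inj.
rewrite right_bis_of_autE; first by []. by have [] := aut_group P.
Qed.
End IdCounit.

Theorem proposition4p4 (k : fieldType) (H : hopfAlgType k)
  (P : comodAlgType H) :
  hopf_galois P ->
  faithfully_flat (@coinv_act k H P) ->
  group_isomorphic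
    [set sigma : ES P -> coinv P |
       left_bisection (@ES_source k H P) (@ES_target k H P) sigma]
    (left_bis_mul (@ES_coprod k H P)) (@ES_counit k H P)
    (@comod_alg_aut k H P) (fun F G : P -> P => F \o G) idfun
  /\
  (bijective (@hantipode k H) ->
   group_isomorphic
     (@comod_alg_aut k H P) (fun F G : P -> P => F \o G) idfun
     [set sigma : ES P -> coinv P |
        right_bisection (@ES_source k H P) (@ES_target k H P) sigma]
     (right_bis_mul (@ES_coprod k H P)) (@ES_counit k H P)).
Proof.
move=> galP ffP; split=> [|_].
  rewrite -left_bis_of_aut_id; apply: group_isomorphic_transport_sym.
  - exact: aut_group.
  - exact: left_bis_of_aut_bijective.
  - exact: left_bis_mul_of_aut.
rewrite -right_bis_of_aut_id; apply: group_isomorphic_transport.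
- exact: aut_group.
- exact: right_bis_of_aut_bijective.
- exact: right_bis_mul_of_aut.
Qed.
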